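(* Let $\mathbf A$ be a semilinear De Morgan monoid. Then the following are equivalent: (1) $\mathbf A$ is negatively generated; (2) $\mathbf A$ is isomorphic to a subdirect product of algebras each of which is either a totally ordered Sugihara monoid or a De Morgan monoid of the form $\mathbf S[R(\mathbf D)]$, where $\mathbf S$ is an FSI odd Sugihara monoid and $\mathbf D$ is an FSI generalized Sugihara monoid; (3) $\mathbf A$ satisfies the equation $$x=\big(d(\sigma(x))\wedge\sigma(x)\big)\vee\big(d'(\sigma'(x))\wedge\sigma'(x)\big)\vee\big((f^2\vee\neg(f^2))\to\sigma'(x)\big),$$ where $d'(x):=(f^2\to(x\cdot f))\wedge(f^2\cdot\neg x)$, $\sigma(x):=(x\wedge e)\cdot(x^*\wedge e)^*$, $d(x):=d'(\neg x)$ and $\sigma'(x):=\neg\sigma(\neg x)$.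
   Context: An involutive residuated lattice (IRL) is an algebra $\langle A;\cdot,\wedge,\vee,\neg,e\rangle$ with $\langle A;\cdot,e\rangle$ a commutative monoid, $\langle A;\wedge,\vee\rangle$ a lattice, $\neg\neg x=x$, and $x\cdot y\leqslant z\iff\neg z\cdot y\leqslant\neg x$. Define $x\to y:=\neg(x\cdot\neg y)$, $f:=\neg e$, $f^2:=f\cdot f$, $x^*:=x\to e$. A De Morgan monoid is an IRL with distributive lattice satisfying $x\leqslant x\cdot x$; semilinear if isomorphic to a subdirect product of totally ordered De Morgan monoids; negatively generated if generated by $\{a:a\leqslant e\}$. A Sugihara monoid is a De Morgan monoid with $a\cdot a=a$ for all $a$; odd if $f=e$. FSI (finitely subdirectly irreducible): identity congruence meet-irreducible in the congruence lattice. A (commutative) residuated lattice (RL) is $\langle A;\cdot,\to,\wedge,\vee,e\rangle$ with commutative monoid, lattice and $x\cdot y\leqslant z\iff y\leqslant x\to z$; a Dunn monoid is a distributive RL with $x\leqslant x\cdot x$; a generalized Sugihara monoid is an RL isomorphic to a subdirect product of totally ordered RLs, with $a\cdot a=a$ for all $a$, satisfying $(x\vee e)^{**}=x\vee e$. Reflection: for a Dunn monoid $\mathbf D$, with disjoint copy $D'=\{a':a\in D\}$ and new elements $0,1$, $R(\mathbf D)$ is the De Morgan monoid on $D\cup D'\cup\{0,1\}$ such that $\mathbf D$ is a subalgebra of its RL-reduct and, for $a,b\in D$, $x\in R(D)$: $0<a<b'<1$; $a'\leqslant b'$ iff $b\leqslant a$; $x\cdot0=0$; $a'\cdot b'=1$;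 $x\cdot1=1$ if $x\neq0$; $a\cdot b'=(a\to b)'$; $\neg a=a'$, $\neg(a')=a$, $\neg0=1$, $\neg1=0$. Rigorous extension: for a De Morgan monoid $\mathbf B$ and a totally ordered odd Sugihara monoid $\mathbf S$ (disjoint), $\mathbf S[\mathbf B]$ has universe $(S\setminus\{e^{\mathbf S}\})\cup B$, neutral element $e^{\mathbf B}$, operations $\neg$, $\star\in\{\wedge,\vee,\cdot\}$ agreeing with $\mathbf S$ on $S\setminus\{e^{\mathbf S}\}$ and with $\mathbf B$ on $B$, and for $s\in S\setminus\{e^{\mathbf S}\}$, $b\in B$: $b\star s=s\star b=b$ if $e^{\mathbf S}\star^{\mathbf S}s=e^{\mathbf S}$, and $=e^{\mathbf S}\star^{\mathbf S}s$ otherwise. *)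

(* Defs.v *)
Set Warnings "-notation-overridden".
From mathcomp Require Import all_boot.
From mathcomp Require Import boolp.

Set Implicit Arguments.
Unset Strict Implicit.
Unset Printing Implicit Defensive.

Declare Scope drl_scope.
Delimit Scope drl_scope with drl.
Local Open Scope drl_scope.

Record lmAlg := LmAlg {
  lm_sort :> Type;
  mul : lm_sort -> lm_sort -> lm_sort;
  meet : lm_sort -> lm_sort -> lm_sort;
  join : lm_sort -> lm_sort -> lm_sort;
  unit_e : lm_sort }.

Record irAlg := IrAlg {
  ir_lm :> lmAlg;
  neg : ir_lm -> ir_lm }.

Record rlAlg := RlAlg {
  rl_lm :> lmAlg;
  imp : rl_lm -> rl_lm -> rl_lm }.

Arguments mul {l} _ _.
Arguments meet {l} _ _.
Arguments join {l} _ _.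
Arguments unit_e {l}.
Arguments neg {i} _.
Arguments imp {r} _ _.

Notation "¬ x" := (neg x) (at level 35, right associativity) : drl_scope.
Notation "x * y" := (mul x y) : drl_scope.
Notation "x ⊓ y" := (meet x y) (at level 48, left associativity) : drl_scope.
Notation "x ⊔ y" := (join x y) (at level 49, left associativity) : drl_scope.

Definition lm_le (L : lmAlg) (x y : L) : Prop := x ⊓ y = x.
Notation "x ⊑ y" := (lm_le x y) (at level 70, no associativity) : drl_scope.

Definition ir_imp (A : irAlg) (x y : A) : A := ¬ (x * ¬ y).
Notation "x ⇒ y" := (ir_imp x y) (at level 53, right associativity) : drl_scope.

Definition ir_f (A : irAlg) : A := ¬ unit_e.
Definition ir_f2 (A : irAlg) : A := ir_f A * ir_f A.
Definition ir_star (A : irAlg) (x : A) : A := x ⇒ unit_e.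
Definition rl_star (D : rlAlg) (x : D) : D := imp x unit_e.

Record comm_monoid (L : lmAlg) : Prop := CommMonoid {
  cm_assoc : associative (@mul L);
  cm_comm : commutative (@mul L);
  cm_unit : left_id (@unit_e L) (@mul L) }.

Record lattice (L : lmAlg) : Prop := Lattice {
  lat_meetC : commutative (@meet L);
  lat_meetA : associative (@meet L);
  lat_joinC : commutative (@join L);
  lat_joinA : associative (@join L);
  lat_meetK : forall x y : L, x ⊓ (x ⊔ y) = x;
  lat_joinK : forall x y : L, x ⊔ (x ⊓ y) = x }.

Definition distributive (L : lmAlg) : Prop :=
  forall x y z : L, x ⊓ (y ⊔ z) = (x ⊓ y) ⊔ (x ⊓ z).

Definition square_increasing (L : lmAlg) : Prop := forall x : L, x ⊑ x * x.

Definition idempotent (L : lmAlg) : Prop := forall x : L, x * x = x.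

Definition totally_ordered (L : lmAlg) : Prop :=
  forall x y : L, x ⊑ y \/ y ⊑ x.

Record is_IRL (A : irAlg) : Prop := IsIRL {
  irl_monoid : comm_monoid A;
  irl_lattice : lattice A;
  irl_negK : forall x : A, ¬ ¬ x = x;
  irl_resid : forall x y z : A, x * y ⊑ z <-> (¬ z) * y ⊑ ¬ x }.

Record is_RL (D : rlAlg) : Prop := IsRL {
  rl_monoid : comm_monoid D;
  rl_lattice : lattice D;
  rl_resid : forall x y z : D, x * y ⊑ z <-> y ⊑ imp x z }.

Record is_DeMorgan (A : irAlg) : Prop := IsDeMorgan {
  dm_irl : is_IRL A;
  dm_distr : distributive A;
  dm_sqinc : square_increasing A }.

Definition is_Sugihara (A : irAlg) : Prop := is_DeMorgan A /\ idempotent A.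

Definition is_odd_Sugihara (A : irAlg) : Prop :=
  is_Sugihara A /\ ir_f A = unit_e.

Definition lm_prod (I : Type) (B : I -> lmAlg) : lmAlg :=
  @LmAlg (forall i, B i)
    (fun u v i => u i * v i)
    (fun u v i => u i ⊓ v i)
    (fun u v i => u i ⊔ v i)
    (fun i => unit_e).

Definition ir_prod (I : Type) (B : I -> irAlg) : irAlg :=
  @IrAlg (lm_prod (fun i => ir_lm (B i))) (fun u i => ¬ u i).

Definition rl_prod (I : Type) (B : I -> rlAlg) : rlAlg :=
  @RlAlg (lm_prod (fun i => rl_lm (B i))) (fun u v i => imp (u i) (v i)).

Record lm_hom (L M : lmAlg) (h : L -> M) : Prop := LmHom {
  hom_mul : forall x y, h (x * y) = h x * h y;
  hom_meet : forall x y, h (x ⊓ y) = h x ⊓ h y;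
  hom_join : forall x y, h (x ⊔ y) = h x ⊔ h y;
  hom_unit : h unit_e = unit_e }.

Definition ir_hom (A B : irAlg) (h : A -> B) : Prop :=
  lm_hom h /\ forall x, h (¬ x) = ¬ h x.

Definition rl_hom (D E : rlAlg) (h : D -> E) : Prop :=
  lm_hom h /\ forall x y, h (imp x y) = imp (h x) (h y).

(* A is isomorphic to a subdirect product of members of K: h is an isomorphism
   from A onto a subalgebra of the product (the image of h) that projects onto
   every factor. *)
Definition ir_subdirect_of (K : irAlg -> Prop) (A : irAlg) : Prop :=
  exists (I : Type) (B : I -> irAlg) (h : A -> ir_prod B),
    [/\ forall i, K (B i), ir_hom h, injective h
      & forall i (b : B i), exists a : A, h a i = b].

Definition rl_subdirect_of (K : rlAlg -> Prop) (D : rlAlg) : Prop :=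
  exists (I : Type) (B : I -> rlAlg) (h : D -> rl_prod B),
    [/\ forall i, K (B i), rl_hom h, injective h
      & forall i (b : B i), exists a : D, h a i = b].

Definition semilinear (A : irAlg) : Prop :=
  ir_subdirect_of (fun B => is_DeMorgan B /\ totally_ordered B) A.

Record is_gen_Sugihara (D : rlAlg) : Prop := IsGenSugihara {
  gs_rl : is_RL D;
  gs_semilinear :
    rl_subdirect_of (fun B => is_RL B /\ totally_ordered B) D;
  gs_idem : idempotent D;
  gs_star : forall x : D, rl_star (rl_star (x ⊔ unit_e)) = x ⊔ unit_e }.

Record ir_subuniverse (A : irAlg) (P : A -> Prop) : Prop := IrSubuniverse {
  su_mul : forall x y, P x -> P y -> P (x * y);
  su_meet : forall x y, P x -> P y -> P (x ⊓ y);
  su_join : forall x y, P x -> P y -> P (x ⊔ y);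
  su_unit : P unit_e;
  su_neg : forall x, P x -> P (¬ x) }.

Definition negatively_generated (A : irAlg) : Prop :=
  forall P : A -> Prop,
    ir_subuniverse P -> (forall a : A, a ⊑ unit_e -> P a) ->
    forall a : A, P a.

Record lm_congruence (L : lmAlg) (R : L -> L -> Prop) : Prop := LmCongruence {
  cg_refl : forall x, R x x;
  cg_sym : forall x y, R x y -> R y x;
  cg_trans : forall x y z, R x y -> R y z -> R x z;
  cg_mul : forall x x' y y', R x x' -> R y y' -> R (x * y) (x' * y');
  cg_meet : forall x x' y y', R x x' -> R y y' -> R (x ⊓ y) (x' ⊓ y');
  cg_join : forall x x' y y', R x x' -> R y y' -> R (x ⊔ y) (x' ⊔ y') }.

Definition ir_congruence (A : irAlg) (R : A -> A -> Prop) : Prop :=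
  lm_congruence R /\ forall x x', R x x' -> R (¬ x) (¬ x').

Definition rl_congruence (D : rlAlg) (R : D -> D -> Prop) : Prop :=
  lm_congruence R /\
  forall x x' y y', R x x' -> R y y' -> R (imp x y) (imp x' y').

(* Every congruence contains the identity, so "R = id" is stated as
   "R is contained in id", and similarly for the intersection of R1 and R2.
   Trivial algebras are FSI, as is needed for S[R(D)] to include R(D) itself
   and for R(D) to include the four-element chain. *)
Definition ir_FSI (A : irAlg) : Prop :=
  forall R1 R2 : A -> A -> Prop, ir_congruence R1 -> ir_congruence R2 ->
    (forall x y, R1 x y /\ R2 x y -> x = y) ->
    (forall x y, R1 x y -> x = y) \/ (forall x y, R2 x y -> x = y).

Definition rl_FSI (D : rlAlg) : Prop :=
  forall R1 R2 : D -> D -> Prop, rl_congruence R1 -> rl_congruence R2 ->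
    (forall x y, R1 x y /\ R2 x y -> x = y) ->
    (forall x y, R1 x y -> x = y) \/ (forall x y, R2 x y -> x = y).

Inductive refl_sort (D : Type) : Type :=
  | Rzero | Rbase of D | Rprime of D | Rone.
Arguments Rzero {D}.
Arguments Rone {D}.

Section Reflection.
Variable D : rlAlg.
Implicit Types u v : refl_sort D.

Definition refl_mul u v :=
  match u, v with
  | Rzero, _ | _, Rzero => Rzero
  | Rone, _ | _, Rone => Rone
  | Rbase a, Rbase b => Rbase (a * b)
  | Rbase a, Rprime b | Rprime b, Rbase a => Rprime (imp a b)
  | Rprime _, Rprime _ => Rone
  end.

(* meet and join are those of the order with 0 < a < b' < 1 for all a, b in D
   that extends the order of D and is reversed by a |-> a'. *)
Definition refl_meet u v :=
  match u, v with
  | Rzero, _ | _, Rzero => Rzero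
  | Rone, w | w, Rone => w
  | Rbase a, Rbase b => Rbase (a ⊓ b)
  | Rbase a, Rprime _ | Rprime _, Rbase a => Rbase a
  | Rprime a, Rprime b => Rprime (a ⊔ b)
  end.

Definition refl_join u v :=
  match u, v with
  | Rone, _ | _, Rone => Rone
  | Rzero, w | w, Rzero => w
  | Rbase a, Rbase b => Rbase (a ⊔ b)
  | Rbase _, Rprime b | Rprime b, Rbase _ => Rprime b
  | Rprime a, Rprime b => Rprime (a ⊓ b)
  end.

Definition refl_neg u :=
  match u with
  | Rzero => Rone
  | Rbase a => Rprime a
  | Rprime a => Rbase a
  | Rone => Rzero
  end.

Definition reflection : irAlg :=
  @IrAlg (@LmAlg (refl_sort D) refl_mul refl_meet refl_join (Rbase unit_e))
    refl_neg.

End Reflection.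

Section RigorousExtension.
Variables S B : irAlg.

Definition rig_sort : Type := ({s : S | s <> unit_e} + B)%type.

Definition rig_in (b : B) (s : S) : rig_sort :=
  match pselect (s = unit_e) with
  | left _ => inr b
  | right ns => inl (exist _ s ns)
  end.

(* In the case of two elements of S other than e, and in rig_neg, the default
   unit_e of rig_in is never used when S is a totally ordered odd Sugihara
   monoid: the complement of {e} is then closed under all the operations. *)
Definition rig_op (opS : S -> S -> S) (opB : B -> B -> B) (u v : rig_sort) :
    rig_sort :=
  match u, v with
  | inl s, inl t => rig_in unit_e (opS (proj1_sig s) (proj1_sig t))
  | inl s, inr b | inr b, inl s => rig_in b (opS unit_e (proj1_sig s))
  | inr b, inr c => inr (opB b c)
  end.

Definition rig_neg (u : rig_sort) : rig_sort :=
  match u with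
  | inl s => rig_in unit_e (¬ proj1_sig s)
  | inr b => inr (¬ b)
  end.

Definition rigorous_ext : irAlg :=
  @IrAlg (@LmAlg rig_sort (rig_op mul mul) (rig_op meet meet)
            (rig_op join join) (inr unit_e))
    rig_neg.

End RigorousExtension.

Definition of_form_SRD (C : irAlg) : Prop :=
  exists (S : irAlg) (D : rlAlg),
    [/\ is_odd_Sugihara S, ir_FSI S, is_gen_Sugihara D, rl_FSI D
      & C = rigorous_ext S (reflection D)].

Section Terms.
Variable A : irAlg.
Implicit Type x : A.

Definition t_d' x : A :=
  (ir_f2 A ⇒ (x * ir_f A)) ⊓ (ir_f2 A * ¬ x).

Definition t_sigma x : A :=
  (x ⊓ unit_e) * ir_star (ir_star x ⊓ unit_e).

Definition t_d x : A := t_d' (¬ x).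

Definition t_sigma' x : A := ¬ t_sigma (¬ x).

End Terms.

(* Main.v *)
(* Condition (3) gives (1) because its right-hand side is a term in the negative
   elements x ∧ e, x* ∧ e, ¬x ∧ e and (¬x)* ∧ e; the rest is about chains.  Let C
   be a De Morgan chain.  If f ≤ e, then C is idempotent.  Otherwise put 1 = f²
   and 0 = ¬1: elements outside [0, 1] are idempotent, multiply as in a Sugihara
   chain and absorb [0, 1], so together with e (taken as its own negation) they
   form an odd Sugihara chain S.  The set D of all c and c* with 0 < c ≤ e is
   closed under the RL operations, lies below ¬D, and ¬D · ¬D = {1}; hence
   S ∪ {0, 1} ∪ D ∪ ¬D is a subuniverse containing every negative element.  If C
   is negatively generated it is therefore all of C, that is, C ≅ S[R(D)], and
   equation (3) is checked zone by zone.  Conversely, FSI odd or generalized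
   Sugihara monoids are chains by prelinearity, so the factors in (2) are
   negatively generated chains. *)
Set Warnings "-notation-overridden".
From mathcomp Require Import all_boot.
From mathcomp Require Import boolp.
Require Import Defs.

Set Implicit Arguments.
Unset Strict Implicit.
Unset Printing Implicit Defensive.
Local Open Scope drl_scope.

(** * Order facts in lattices and in chains *)

Section LatticeOrder.
Variables (L : lmAlg) (lat : lattice L).
Implicit Types x y z : L.

Lemma meetxx x : x ⊓ x = x.
Proof. by rewrite -{2}(lat_joinK lat x x) (lat_meetK lat). Qed.

Lemma lexx x : x ⊑ x. Proof. exact: meetxx. Qed.

Lemma le_anti x y : x ⊑ y -> y ⊑ x -> x = y.
Proof. by move=> xy yx; rewrite -xy (lat_meetC lat) yx. Qed.

Lemma le_trans y x z : x ⊑ y -> y ⊑ z -> x ⊑ z.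
Proof.
by move=> xy yz; rewrite /lm_le -{1}xy -(lat_meetA lat) yz xy.
Qed.

Lemma leIl x y : x ⊓ y ⊑ x.
Proof. by rewrite /lm_le (lat_meetC lat) (lat_meetA lat) meetxx. Qed.

Lemma leIr x y : x ⊓ y ⊑ y.
Proof. by rewrite /lm_le -(lat_meetA lat) meetxx. Qed.

Lemma lexI x y z : z ⊑ x -> z ⊑ y -> z ⊑ x ⊓ y.
Proof. by move=> zx zy; rewrite /lm_le (lat_meetA lat) zx zy. Qed.

Lemma leUl x y : x ⊑ x ⊔ y.
Proof. exact: lat_meetK. Qed.

Lemma leUr x y : y ⊑ x ⊔ y.
Proof. by rewrite (lat_joinC lat); apply: leUl. Qed.

Lemma joinr x y : x ⊑ y -> x ⊔ y = y.
Proof. by move=> <-; rewrite (lat_joinC lat) (lat_meetC lat) (lat_joinK lat). Qed.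

Lemma joinl x y : y ⊑ x -> x ⊔ y = x.
Proof. by rewrite (lat_joinC lat); apply: joinr. Qed.

Lemma meetr x y : y ⊑ x -> x ⊓ y = y.
Proof. by rewrite (lat_meetC lat). Qed.

Lemma le_joinE x y : x ⊔ y = y -> x ⊑ y.
Proof. by move=> <-; apply: leUl. Qed.

Lemma leUx x y z : x ⊑ z -> y ⊑ z -> x ⊔ y ⊑ z.
Proof.
move=> xz yz; apply: le_joinE.
by rewrite -(lat_joinA lat) (joinr yz) (joinr xz).
Qed.

Lemma nle_le x y : totally_ordered L -> ~ x ⊑ y -> y ⊑ x.
Proof. by move=> tot; case: (tot x y). Qed.

Lemma meet_sel x y : totally_ordered L -> x ⊓ y = x \/ x ⊓ y = y.
Proof. by move=> tot; case: (tot x y) => h; [left | right; apply: meetr]. Qed.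

Lemma join_sel x y : totally_ordered L -> x ⊔ y = x \/ x ⊔ y = y.
Proof.
by move=> tot; case: (tot x y) => h; [right; apply: joinr | left; apply: joinl].
Qed.

End LatticeOrder.

Arguments le_trans {L} lat y {x z}.

(** * Residuated lattices: finite subdirect irreducibility and chains *)

Section ResiduatedLattice.
Variables (D : rlAlg) (rl : is_RL D).
Let lat := rl_lattice rl.
Let mon := rl_monoid rl.
Implicit Types a b c x y z : D.

Local Notation e := (@unit_e D).

Lemma rl_mulC : commutative (@mul D). Proof. exact: cm_comm mon. Qed.

Lemma rl_mulA : associative (@mul D). Proof. exact: cm_assoc mon. Qed.

Lemma rl_mul1 x : e * x = x. Proof. exact: cm_unit mon _. Qed.

Lemma rl_mulr1 x : x * e = x. Proof. by rewrite rl_mulC rl_mul1. Qed.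

Lemma rl_mulCA : left_commutative (@mul D).
Proof. by move=> x y z; rewrite !rl_mulA (rl_mulC x). Qed.

Lemma rl_leM2l x y z : y ⊑ z -> x * y ⊑ x * z.
Proof.
move=> yz; apply/(rl_resid rl); apply: (le_trans lat z) => //.
by apply/(rl_resid rl); apply: lexx.
Qed.

Lemma rl_leM x y z t : x ⊑ y -> z ⊑ t -> x * z ⊑ y * t.
Proof.
move=> xy zt; apply: (le_trans lat (x * t)); first exact: rl_leM2l.
by rewrite !(rl_mulC _ t); apply: rl_leM2l.
Qed.

Lemma rl_impP x y : x * imp x y ⊑ y.
Proof. by apply/(rl_resid rl); apply: lexx. Qed.

Lemma rl_mulUl x y z : (x ⊔ y) * z ⊑ x * z ⊔ y * z.
Proof.
rewrite rl_mulC; apply/(rl_resid rl); apply: (leUx lat); apply/(rl_resid rl);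
rewrite rl_mulC; [exact: leUl|exact: leUr].
Qed.

Lemma rl_imp_ge1 x y : e ⊑ imp x y <-> x ⊑ y.
Proof. by rewrite -(rl_resid rl) rl_mulr1. Qed.

(** If [R x y] with [y] not below [x], then [imp y x ⊓ e] is related to [imp y y ⊓ e], which is [e],
    and lies strictly below it. Two nontrivial congruences thus give [u] and [v] strictly below [e],
    whose join is related to [e] by both and so equals [e]; in a chain the join is [u] or [v], a
    contradiction. *)
Lemma rl_chain_FSI : totally_ordered D -> rl_FSI D.
Proof.
move=> tot R1 R2 c1 c2 R12.
have below_e (R : D -> D -> Prop) x y : rl_congruence R -> R x y -> x <> y ->
    exists2 u, ~ e ⊑ u & R u e.
  move=> [cl ci] Rxy xy.
  wlog nle : x y Rxy xy / ~ y ⊑ x.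
    move=> H; case: (pselect (y ⊑ x)) => yx; last exact: (H x y).
    apply: (H y x) => //; [exact: cg_sym|by move/esym|].
    by move=> /(le_anti lat yx)/esym.
  exists (imp y x ⊓ e).
    move=> h; apply: nle; apply/rl_imp_ge1.
    by apply: (le_trans lat _ h); apply: leIl.
  rewrite -[X in R _ X](_ : imp y y ⊓ e = e); last first.
    by apply: (meetr lat); apply/rl_imp_ge1; apply: lexx.
  apply: (cg_meet cl); last exact: (cg_refl cl).
  by apply: ci => //; apply: (cg_refl cl).
apply: contrapT => /not_orP [/existsNP[x1] /existsNP[y1] /not_implyP[r1 n1]
  /existsNP[x2] /existsNP[y2] /not_implyP[r2 n2]].
have [u nu Ru] := below_e _ _ _ c1 r1 n1.
have [v nv Rv] := below_e _ _ _ c2 r2 n2.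
have ule := nle_le tot nu; have vle := nle_le tot nv.
have : u ⊔ v = e.
  have uve : e ⊔ v = e /\ u ⊔ e = e by split; [apply: joinl|apply: joinr].
  apply: R12; split.
    rewrite -[X in R1 _ X]uve.1.
    by apply: (cg_join c1.1) => //; apply: (cg_refl c1.1).
  rewrite -[X in R2 _ X]uve.2.
  by apply: (cg_join c2.1) => //; apply: (cg_refl c2.1).
by case: (join_sel lat u v tot) => -> E; [apply: nu|apply: nv];
   rewrite E; apply: lexx.
Qed.

(** By residuation, [a] lies below both implications between [x] and [y]. For a negative idempotent
    [a] this is the congruence that collapses [a] to [e]. *)
Definition cone_cong a x y := a * x ⊑ y /\ a * y ⊑ x.

Lemma cone_congP a : a ⊑ e -> a * a = a -> rl_congruence (cone_cong a).
Proof.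
move=> ae aa.
have ale x y : x ⊑ y -> a * x ⊑ y.
  by move=> xy; rewrite -[X in _ ⊑ X]rl_mul1; apply: rl_leM.
split; first split.
- by move=> x; split; apply: ale; apply: lexx.
- by move=> x y [].
- move=> x y z [xy yx] [yz zy]; split; rewrite -aa -rl_mulA.
    by apply: (le_trans lat _ (rl_leM2l _ xy)).
  by apply: (le_trans lat _ (rl_leM2l _ zy)).
- move=> x x' y y' [p q] [r s]; split; rewrite -aa -rl_mulA (rl_mulCA a) rl_mulA;
  by apply: rl_leM.
- move=> x x' y y' [p q] [r s]; split; apply: (lexI lat).
  + exact: (le_trans lat _ (rl_leM2l _ (leIl lat _ _))).
  + exact: (le_trans lat _ (rl_leM2l _ (leIr lat _ _))).
  + exact: (le_trans lat _ (rl_leM2l _ (leIl lat _ _))).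
  + exact: (le_trans lat _ (rl_leM2l _ (leIr lat _ _))).
- move=> x x' y y' [p q] [r s]; split; rewrite rl_mulC;
  apply: (le_trans lat _ (rl_mulUl _ _ _)); apply: (leUx lat); rewrite rl_mulC.
  + exact: (le_trans lat _ p (leUl lat _ _)).
  + exact: (le_trans lat _ r (leUr lat _ _)).
  + exact: (le_trans lat _ q (leUl lat _ _)).
  + exact: (le_trans lat _ s (leUr lat _ _)).
(* Split [a] as [a * a]: one factor turns [x'] into [x], the other turns [y] into [y']. *)
have key x x' y y' : a * x' ⊑ x -> a * y ⊑ y' -> a * imp x y ⊑ imp x' y'.
  move=> p q; apply/(proj1 (rl_resid rl _ _ _)); apply: (le_trans lat _ _ q).
  rewrite -[in X in X ⊑ _]aa -rl_mulA !(rl_mulCA x') rl_mulA -rl_mulA.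
  apply: rl_leM2l; rewrite rl_mulA; apply: (le_trans lat _ _ (rl_impP x y)).
  by apply: rl_leM => //; apply: lexx.
by move=> x x' y y' [p q] [r s]; split; apply: key.
Qed.

(** The negative parts of [imp x y] and [imp y x] join to [e], so their cone congruences meet in the
    identity. One of them is then trivial, which puts [e] below that implication. *)
Lemma rl_FSI_chain : square_increasing D -> rl_FSI D ->
  (forall x y, (imp x y ⊓ e) ⊔ (imp y x ⊓ e) = e) -> totally_ordered D.
Proof.
move=> sq fsi prelin x y.
have ne u : u ⊓ e ⊑ e by apply: leIr.
have idem u : (u ⊓ e) * (u ⊓ e) = u ⊓ e.
  apply: (le_anti lat) (sq _).
  by rewrite -[X in _ ⊑ X]rl_mulr1; apply: rl_leM2l.
have trivial u : (forall x y, cone_cong (u ⊓ e) x y -> x = y) -> e ⊑ u.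
  move=> H; rewrite (H e (u ⊓ e)); first exact: leIl.
  by split; rewrite ?idem // rl_mulr1; apply: lexx.
have := prelin x y; set a := imp x y; set b := imp y x => ab.
case: (fsi _ _ (cone_congP (ne a) (idem a)) (cone_congP (ne b) (idem b))).
- move=> u v [[p q] [r s]]; apply: (le_anti lat).
    rewrite -(rl_mul1 u) -ab; apply: (le_trans lat _ (rl_mulUl _ _ _)).
    exact: (leUx lat).
  rewrite -(rl_mul1 v) -ab; apply: (le_trans lat _ (rl_mulUl _ _ _)).
  exact: (leUx lat).
- by move/trivial/rl_imp_ge1; left.
- by move/trivial/rl_imp_ge1; right.
Qed.

End ResiduatedLattice.

(** Prelinearity holds in every chain, hence coordinatewise in a subdirect product of chains. *)
Lemma gen_Sugihara_FSI_chain (D : rlAlg) :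
  is_gen_Sugihara D -> rl_FSI D -> totally_ordered D.
Proof.
move=> [rl [I [B [h [KB hh inj _]]]] idem _] fsi.
apply: (rl_FSI_chain rl) => //.
  by move=> x; rewrite idem; apply: lexx (rl_lattice rl) _.
move=> x y; apply: inj; apply: functional_extensionality_dep => i.
have [hl hi] := hh; have [rlB totB] := KB i.
rewrite (hom_join hl) !(hom_meet hl) !hi (hom_unit hl) /=.
have latB := rl_lattice rlB.
have below u : u ⊓ unit_e ⊑ @unit_e (B i) by apply: leIr.
case: (totB (h x i) (h y i)) => /(rl_imp_ge1 rlB) k.
  by rewrite (meetr latB k) (joinl latB (below _)).
by rewrite (meetr latB k) (joinr latB (below _)).
Qed.

(** * Involutive residuated lattices viewed as residuated lattices *)

Definition rl_of (A : irAlg) : rlAlg := @RlAlg A (@ir_imp A).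

Lemma rl_of_RL (A : irAlg) : is_IRL A -> is_RL (rl_of A).
Proof.
move=> irl; have [mon lat negK res] := irl.
have leN (a b : A) : ¬ b ⊑ ¬ a <-> a ⊑ b.
  by have := res a unit_e b; rewrite ![_ * unit_e](cm_comm mon) !(cm_unit mon) => <-.
split => // x y z /=; rewrite /ir_imp.
by rewrite (cm_comm mon) res -{1}[¬ z * x]negK leN (cm_comm mon).
Qed.

(** The two signatures have the same congruences: implication is a term in product and negation, and
    negation is implication into [f]. *)
Lemma ir_FSI_rl_of (A : irAlg) : is_IRL A -> ir_FSI A <-> rl_FSI (rl_of A).
Proof.
move=> irl; have [mon lat negK res] := irl.
have cong R : ir_congruence R <-> rl_congruence (R : rl_of A -> rl_of A -> Prop).
  have negE (x : A) : ¬ x = x ⇒ ¬ unit_e.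
    by rewrite /ir_imp negK [_ * _](cm_comm mon) (cm_unit mon).
  split=> -[cl cn].
    split=> [//|x x' y y' p q].
    by apply: (cn (x * ¬ y)); apply: (cg_mul cl) => //; apply: cn.
  split=> [//|x x' p].
  by rewrite (negE x) (negE x'); apply: (cn x) => //; apply: (cg_refl cl).
by split=> fsi R1 R2 /cong c1 /cong c2; apply: fsi.
Qed.

(** * Arithmetic of De Morgan monoids *)

Section DeMorganMonoid.
Variables (C : irAlg) (dm : is_DeMorgan C).
Let irl := dm_irl dm.
Let lat := irl_lattice irl.
Let rl := rl_of_RL irl.
Implicit Types a b c x y z : C.
Local Notation e := (@unit_e C).
Local Notation f := (ir_f C).
Local Notation f2 := (ir_f2 C).

Lemma mulC x y : x * y = y * x. Proof. exact: (rl_mulC rl). Qed.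
Lemma mulA x y z : x * (y * z) = (x * y) * z. Proof. exact: (rl_mulA rl). Qed.
Lemma mul1 x : e * x = x. Proof. exact: (rl_mul1 rl). Qed.
Lemma mulr1 x : x * e = x. Proof. exact: (rl_mulr1 rl). Qed.
Lemma mulCA x y z : x * (y * z) = y * (x * z). Proof. exact: (rl_mulCA rl). Qed.
Lemma mulAC x y z : x * y * z = x * z * y.
Proof. by rewrite -!mulA (mulC y). Qed.
Lemma mulACA x y z t : x * y * (z * t) = x * z * (y * t).
Proof. by rewrite -!mulA (mulCA y). Qed.
Lemma negK x : ¬ ¬ x = x. Proof. exact: irl_negK irl _. Qed.
Lemma negf : ¬ f = e. Proof. exact: negK. Qed.

Lemma leM x y z t : x ⊑ y -> z ⊑ t -> x * z ⊑ y * t.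
Proof. exact: (rl_leM rl). Qed.

Lemma leMl x y z : x ⊑ y -> x * z ⊑ y * z.
Proof. by move=> xy; apply: leM => //; apply: lexx. Qed.

Lemma leMr x y z : x ⊑ y -> z * x ⊑ z * y.
Proof. by move=> xy; apply: leM => //; apply: lexx. Qed.

Lemma leN x y : ¬ y ⊑ ¬ x <-> x ⊑ y.
Proof. by have := irl_resid irl x e y; rewrite !mulr1 => <-. Qed.

Lemma leNl x y : ¬ x ⊑ y <-> ¬ y ⊑ x.
Proof. by rewrite -{1}(negK y) leN. Qed.

Lemma leNr x y : x ⊑ ¬ y <-> y ⊑ ¬ x.
Proof. by rewrite -{1}(negK x) leN. Qed.

(** Most inequalities below are proved in this form, as products bounded by [f]. *)
Lemma le_mulf x y : x ⊑ y <-> x * ¬ y ⊑ f.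
Proof.
by rewrite (irl_resid irl) negf mul1 leN.
Qed.

Lemma leM_impE x y z : x * y ⊑ z <-> y ⊑ x ⇒ z.
Proof. exact: (rl_resid rl). Qed.

Lemma mulN_lef x : x * ¬ x ⊑ f.
Proof. by rewrite -le_mulf; apply: lexx. Qed.

Lemma leMe x y : y ⊑ e -> x * y ⊑ x.
Proof. by move=> ye; rewrite -[X in _ ⊑ X]mulr1; apply: leMr. Qed.

Lemma leM1 x y : e ⊑ y -> x ⊑ x * y.
Proof. by move=> ye; rewrite -[X in X ⊑ _]mulr1; apply: leMr. Qed.

Lemma le_sqr x : x ⊑ x * x. Proof. exact: dm_sqinc dm _. Qed.

Lemma negative_idem a : a ⊑ e -> a * a = a.
Proof. by move=> ae; apply: (le_anti lat) (le_sqr a); apply: leMe. Qed.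

Lemma negative_mul a b : a ⊑ b -> b ⊑ e -> a * b = a.
Proof.
move=> ab be; apply: (le_anti lat); first exact: leMe.
by rewrite -[X in X ⊑ _](negative_idem (le_trans lat _ ab be)); apply: leMr.
Qed.

(** Enlarging [¬ x] to its square gives x·x·¬x ≤ (x·¬x)² ≤ f·f ≤ f. *)
Lemma le_f_idem : f ⊑ e -> idempotent C.
Proof.
move=> fe x; apply: (le_anti lat) (le_sqr x); apply/le_mulf.
apply: (le_trans lat (x * ¬ x * (x * ¬ x))).
  by rewrite mulACA; apply: leMr; apply: le_sqr.
apply: (le_trans lat (f * f)); last exact: leMe.
by apply: leM; apply: mulN_lef.
Qed.

Lemma f2_le_f : f2 ⊑ f -> f ⊑ e.
Proof. by move=> /(irl_resid irl); rewrite !negf mul1. Qed.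

Lemma ir_starE x : ir_star x = ¬ (x * f). Proof. by []. Qed.

Lemma starP x : x * ir_star x ⊑ e.
Proof. by apply/leM_impE; apply: lexx. Qed.

Lemma le_star2 x : x ⊑ ir_star (ir_star x).
Proof. by apply/leM_impE; rewrite mulC; apply: starP. Qed.

Lemma star_anti x y : x ⊑ y -> ir_star y ⊑ ir_star x.
Proof. by move=> xy; rewrite !ir_starE leN; apply: leMl. Qed.

Lemma star3 x : ir_star (ir_star (ir_star x)) = ir_star x.
Proof.
by apply: (le_anti lat); [apply: star_anti|]; apply: le_star2.
Qed.

Lemma star_e : ir_star e = e. Proof. by rewrite ir_starE mul1 negf. Qed.

Lemma star_ge1 x : x ⊑ e -> e ⊑ ir_star x.
Proof. by move=> xe; rewrite -star_e; apply: star_anti. Qed.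

Lemma star_le1 x : e ⊑ x -> ir_star x ⊑ e.
Proof. by move=> xe; rewrite -star_e; apply: star_anti. Qed.

Lemma e_imp x : e ⇒ x = x.
Proof. by rewrite /ir_imp mul1 negK. Qed.

Lemma imp_le x y : e ⊑ x -> x ⇒ y ⊑ y.
Proof.
by move=> ex; rewrite -[X in _ ⊑ X]e_imp /ir_imp leN; apply: leMl.
Qed.

(** On a chain this and the next lemma determine σ completely. *)
Lemma sigma_neg x : x ⊑ e -> t_sigma x = x.
Proof.
move=> xe; rewrite /t_sigma xe (meetr lat (star_ge1 xe)).
by rewrite star_e mulr1.
Qed.

Lemma sigma_pos x : e ⊑ x -> t_sigma x = ir_star (ir_star x).
Proof.
by move=> ex; rewrite /t_sigma (meetr lat ex) (star_le1 ex) mul1.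
Qed.

Lemma negN_le_f x : ¬ x ⊑ e <-> f ⊑ x.
Proof. by rewrite leNl. Qed.

Lemma sigma'_le x : x ⊑ f -> t_sigma' x ⊑ x.
Proof.
move=> xf; rewrite /t_sigma' sigma_pos; last by rewrite leNr.
by rewrite leNl; apply: le_star2.
Qed.

Lemma sigma'_ge_f x : f ⊑ x -> t_sigma' x = x.
Proof. by move=> fx; rewrite /t_sigma' sigma_neg ?negK //; apply/negN_le_f. Qed.

End DeMorganMonoid.

(** * De Morgan chains: the elements f² and ¬f², and the elements beyond them *)

Section DeMorganChain.
Variables (C : irAlg) (dm : is_DeMorgan C) (tot : totally_ordered C).
Let irl := dm_irl dm.
Let lat := irl_lattice irl.
Implicit Types a b c d x y z : C.
Local Notation e := (@unit_e C).
Local Notation f := (ir_f C).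
Local Notation f2 := (ir_f2 C).
Local Notation bot := (¬ f2).

(** Put c = ¬(a·b), a negative element; the claim is a·c ≤ f, and a·b·c ≤ f is known. If c ≤ b then
    b·c = c and this is the claim; if b ≤ c then b·c = b, so a·b ≤ f against the assumption. *)
Lemma chain_absorb a b : b ⊑ e -> ~ a * b ⊑ f -> a ⊑ a * b.
Proof.
move=> be nab; have ce : ¬ (a * b) ⊑ e.
  by apply: (nle_le tot) => h; apply: nab; rewrite -(leNr dm).
rewrite (le_mulf dm); set c := ¬ (a * b) in ce *.
have h : a * b * c ⊑ f by apply: mulN_lef.
case: (tot c b) => [cb|bc].
  by rewrite -(negative_mul dm cb be) (mulC dm c) (mulA dm).
by case: nab; rewrite -[b](negative_mul dm bc ce) (mulA dm).
Qed.

Lemma idem_le_f : idempotent C -> f ⊑ e.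
Proof. by move=> idem; apply: (f2_le_f dm); rewrite /ir_f2 idem; apply: lexx. Qed.

Hypothesis nfe : ~ f ⊑ e.

Lemma le_e_f : e ⊑ f. Proof. exact: (nle_le tot nfe). Qed.

Lemma le_f_f2 : f ⊑ f2. Proof. exact: (leM1 dm _ le_e_f). Qed.

Lemma le_e_f2 : e ⊑ f2. Proof. exact: (le_trans lat _ le_e_f le_f_f2). Qed.

Lemma nle_f2_f : ~ f2 ⊑ f. Proof. by move/(f2_le_f dm). Qed.

Lemma bot_le_e : bot ⊑ e.
Proof. by rewrite (leNl dm); apply: le_f_f2. Qed.

Lemma nle_e_bot : ~ e ⊑ bot.
Proof. by rewrite (leNr dm); apply: nle_f2_f. Qed.

Lemma bot_le_f2 : bot ⊑ f2.
Proof. exact: (le_trans lat _ bot_le_e le_e_f2). Qed.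

Lemma f_bot_le : f * bot ⊑ e. Proof. exact: (starP dm f). Qed.

(** For f³ ≤ f² it suffices that f³·¬f² ≤ f. As ¬f² lies below its square, the product is at most
    (f·¬f²)²·f, and f·¬f² ≤ e. *)
Lemma f2_mulf : f2 * f = f2.
Proof.
apply: (le_anti lat); last exact: (leM1 dm _ le_e_f).
rewrite (le_mulf dm) (mulAC dm) -(mulA dm f2).
apply: (le_trans lat (f * bot * (f * bot) * f)); last first.
  rewrite -[X in _ ⊑ X](mul1 dm) -[in X in _ ⊑ X](mul1 dm e).
  by apply: (leMl dm); apply: (leM dm); apply: f_bot_le.
rewrite (mulACA dm) (mulA dm f2); apply: (leMl dm); apply: (leMr dm).
exact: le_sqr.
Qed.

Lemma f2_idem : f2 * f2 = f2.
Proof. by rewrite {2}/ir_f2 (mulA dm) !f2_mulf. Qed.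

(** Here [¬ a] is a negative idempotent below ¬f², so a·¬a = a·¬a·¬a ≤ f·¬f² ≤ e. Hence a·a·¬a =
    (a·¬a)² ≤ e ≤ f. *)
Lemma high_idem a : f2 ⊑ a -> a * a = a.
Proof.
move=> ha; apply: (le_anti lat) (le_sqr dm a); rewrite (le_mulf dm).
have nab : ¬ a ⊑ bot by rewrite (leN dm).
have nn : ¬ a * ¬ a = ¬ a.
  by apply: (negative_idem dm); apply: (le_trans lat _ nab bot_le_e).
have ana : a * ¬ a ⊑ e.
  rewrite -nn (mulA dm); apply: (le_trans lat _ _ f_bot_le).
  by apply: (leM dm) => //; apply: mulN_lef.
rewrite -nn (mulACA dm); apply: (le_trans lat _ _ le_e_f).
by rewrite -[X in _ ⊑ X](mul1 dm); apply: (leM dm).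
Qed.

(** This and the next two lemmas reproduce the products of a Sugihara chain: the larger of two high
    elements wins, and a high [a] against a low [b] is decided by comparing [a] with [¬ b]. *)
Lemma high_mul a b : f2 ⊑ a -> a ⊑ b -> a * b = b.
Proof.
move=> ha ab; have hb := le_trans lat _ ha ab; apply: (le_anti lat).
  by rewrite -[X in _ ⊑ X](high_idem hb); apply: (leMl dm).
by rewrite (mulC dm); apply: (leM1 dm); apply: (le_trans lat _ le_e_f2).
Qed.

Lemma high_low_mull a b : f2 ⊑ a -> a ⊑ ¬ b -> a * b = b.
Proof.
move=> ha ab; have hb := le_trans lat _ ha ab; apply: (le_anti lat).
  apply: (le_trans lat (¬ b * b)); first exact: (leMl dm).
  rewrite (le_mulf dm) (mulAC dm) (high_idem hb) (mulC dm).
  exact: mulN_lef.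
by rewrite (mulC dm); apply: (leM1 dm); apply: (le_trans lat _ le_e_f2).
Qed.

Lemma high_low_mulr a b : b ⊑ bot -> ~ a ⊑ ¬ b -> a * b = a.
Proof.
move=> hb nab; have be := le_trans lat _ hb bot_le_e.
apply: (le_anti lat); first exact: leMe.
by apply: chain_absorb => // h; apply: nab; rewrite (le_mulf dm) (negK dm).
Qed.

(** * The interval [0, 1], the set D and the zones of a chain with f not below e *)

Definition inner a := bot ⊑ a /\ a ⊑ f2.

Lemma inner_neg a : inner (¬ a) <-> inner a.
Proof. by rewrite /inner (leN dm) (leNl dm) and_comm. Qed.

Lemma inner_e : inner e.
Proof. by split; [apply: bot_le_e | apply: le_e_f2]. Qed.

Lemma not_innerP a : ~ inner a <-> ~ bot ⊑ a \/ ~ a ⊑ f2.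
Proof. exact: not_andP. Qed.

Lemma not_inner_extreme a : ~ inner a -> a ⊑ bot \/ f2 ⊑ a.
Proof.
by move/not_innerP=> [h|h]; [left|right]; apply: (nle_le tot).
Qed.

Lemma extreme_mul_sel a b :
  a ⊑ bot \/ f2 ⊑ a -> b ⊑ bot \/ f2 ⊑ b -> a * b = a \/ a * b = b.
Proof.
have mixed u v : f2 ⊑ u -> v ⊑ bot -> u * v = u \/ u * v = v.
  move=> hu lv; case: (pselect (u ⊑ ¬ v)) => h.
    by right; apply: high_low_mull.
  by left; apply: high_low_mulr.
move=> [la|ha] [lb|hb].
- have ae := le_trans lat _ la bot_le_e; have be := le_trans lat _ lb bot_le_e.
  case: (tot a b) => h; first by left; apply: (negative_mul dm).
  by right; rewrite (mulC dm); apply: (negative_mul dm).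
- by rewrite (mulC dm); case: (mixed b a hb la); [right|left].
- exact: mixed.
- case: (tot a b) => h; first by right; apply: high_mul.
  by left; rewrite (mulC dm); apply: high_mul.
Qed.

(** By monotonicity it is enough to multiply by the two endpoints of the interval. *)
Lemma outer_mul_inner a b : ~ inner a -> inner b -> a * b = a.
Proof.
move=> /not_innerP oa [b0 b1].
suff [p q] : a * bot = a /\ a * f2 = a.
  by apply: (le_anti lat); [rewrite -[X in _ ⊑ X]q|rewrite -[X in X ⊑ _]p];
     apply: (leMr dm).
case: oa => na; have ha := nle_le tot na.
  split; first by apply: (negative_mul dm) => //; apply: bot_le_e.
  by rewrite (mulC dm); apply: high_low_mull; [apply: lexx|rewrite (leNr dm)].
split; last by rewrite (mulC dm); apply: high_mul => //; apply: lexx.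
by apply: high_low_mulr; [apply: lexx|rewrite (negK dm)].
Qed.

Lemma outer_mul_sel a b : ~ inner a -> a * b = a \/ a * b = b.
Proof.
move=> oa; case: (pselect (inner b)) => ib; first by left; apply: outer_mul_inner.
by apply: extreme_mul_sel; apply: not_inner_extreme.
Qed.

Lemma bot_mul_inner b : inner b -> bot * b = bot.
Proof.
move=> [b0 b1]; apply: (le_anti lat).
  apply: (le_trans lat (bot * f2)); first exact: (leMr dm).
  rewrite (mulC dm) high_low_mull ?(negK dm) //; exact: lexx.
rewrite -{1}(negative_idem dm bot_le_e); exact: (leMr dm).
Qed.

(** If instead c·f ≤ e, then c·f² ≤ f, which says c ≤ ¬f². *)
Lemma e_le_mulf c : ~ c ⊑ bot -> e ⊑ c * f.
Proof.
move=> nc; apply: (nle_le tot) => h; apply: nc.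
by rewrite (le_mulf dm) (negK dm) (mulA dm) -(le_mulf dm).
Qed.

(** Since f² = f²·f and e ≤ a·f, the product f²·a = f²·(a·f) is at least f². *)
Lemma f2_mul a : ~ a ⊑ bot -> a ⊑ f2 -> f2 * a = f2.
Proof.
move=> na a1; apply: (le_anti lat).
  by rewrite -[X in _ ⊑ X]f2_idem; apply: (leMr dm).
rewrite -{2}f2_mulf (mulAC dm) -(mulA dm); apply: (leM1 dm).
exact: e_le_mulf.
Qed.

Lemma f2_mul_inner a : inner a -> f2 * a = f2 \/ a = bot.
Proof.
move=> [a0 a1]; case: (pselect (a ⊑ bot)) => h.
  by right; apply: (le_anti lat).
by left; apply: f2_mul.
Qed.

(* The copy of D inside C when C = S[R(D)]. *)
Definition base a :=
  exists c, [/\ ~ c ⊑ bot, c ⊑ e & a = c \/ a = ir_star c].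

Lemma base_neg c : ~ c ⊑ bot -> c ⊑ e -> base c.
Proof. by move=> nc ce; exists c; split => //; left. Qed.

Lemma base_star c : ~ c ⊑ bot -> c ⊑ e -> base (ir_star c).
Proof. by move=> nc ce; exists c; split => //; right. Qed.

Lemma base_e : base e.
Proof. by apply: base_neg; [apply: nle_e_bot|apply: lexx]. Qed.

(** A single [c] bounds both shapes of base elements, which spares later order arguments a case
    split. *)
Lemma base_sandwich a : base a ->
  exists c, [/\ ~ c ⊑ bot, c ⊑ e, c ⊑ a & a ⊑ ir_star c].
Proof.
move=> [c [nc ce ac]]; exists c; split=> //; have cs := star_ge1 dm ce.
  by case: ac => ->; [apply: lexx|apply: (le_trans lat _ ce)].
by case: ac => ->; [apply: (le_trans lat _ ce)|apply: lexx].
Qed.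

Lemma base_nbot a : base a -> ~ a ⊑ bot.
Proof.
by move=> /base_sandwich [c [nc _ ca _]] h; apply: nc; apply: (le_trans lat _ ca).
Qed.

Lemma base_le_f a : base a -> a ⊑ f.
Proof.
move=> /base_sandwich [c [nc _ _ ac]]; apply: (le_trans lat _ ac).
by rewrite (leN dm); apply: e_le_mulf.
Qed.

Lemma base_inner a : base a -> inner a.
Proof.
move=> ba; split; first exact: (nle_le tot (base_nbot ba)).
exact: (le_trans lat _ (base_le_f ba) le_f_f2).
Qed.

Lemma base_f2 a : base a -> f2 * a = f2.
Proof. by move=> ba; apply: f2_mul (base_nbot ba) (base_inner ba).2. Qed.

(** From a ≤ [ir_star c] and b ≤ [ir_star d] follow c·f ≤ ¬a and d·f ≤ ¬b. The product is therefore
    at least c·d·f², and f² absorbs [c] and [d]. *)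
Lemma base_NN_mul a b : base a -> base b -> ¬ a * ¬ b = f2.
Proof.
move=> ba bb; have [ia ib] := (base_inner ba, base_inner bb).
apply: (le_anti lat).
  by rewrite -[X in _ ⊑ X]f2_idem; apply: (leM dm); rewrite (leNl dm);
     [apply: ia.1|apply: ib.1].
have [c [nc ce _ ac]] := base_sandwich ba.
have [d [nd de _ bd]] := base_sandwich bb.
have cf2 u : ~ u ⊑ bot -> u ⊑ e -> f2 * u = f2.
  by move=> nu ue; apply: f2_mul => //; apply: (le_trans lat _ ue le_e_f2).
rewrite -{1}(cf2 c) // -{1}(cf2 d) // -(mulA dm) (mulACA dm) (mulC dm).
rewrite [f * c](mulC dm) [f * d](mulC dm) [X in X ⊑ _](mulC dm).
by rewrite [X in X ⊑ _](mulC dm); apply: (leM dm); rewrite (leNr dm).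
Qed.

(** Otherwise f² = ¬a·¬b ≤ ¬a·a ≤ f. This makes D disjoint from its negations, as the reflection
    requires. *)
Lemma base_lt_neg a b : base a -> base b -> ~ ¬ b ⊑ a.
Proof.
move=> ba bb h; apply: nle_f2_f; rewrite -(base_NN_mul ba bb).
apply: (le_trans lat (a * ¬ a)); last exact: mulN_lef.
by rewrite (mulC dm); apply: (leMl dm).
Qed.

Lemma star_idem c : c ⊑ e -> ir_star c * ir_star c = ir_star c.
Proof.
move=> ce; apply: (le_anti lat) (le_sqr dm _); apply/(proj1 (leM_impE dm _ _ _)).
rewrite -{1}(negative_idem dm ce) (mulACA dm) -[X in _ ⊑ X](mul1 dm).
by apply: (leM dm); apply: starP.
Qed.

Lemma base_idem a : base a -> a * a = a.
Proof.
by move=> [c [_ ce [->|->]]]; [apply: (negative_idem dm)|apply: star_idem].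
Qed.

Lemma base_mul a b : base a -> base b -> base (a * b).
Proof.
(* If this product is negative, it is above [c] and hence not below 0. If it is above [e],
   multiplying by the idempotent [ir_star d] shows that it equals [ir_star d]. *)
have mixed c d : ~ c ⊑ bot -> c ⊑ e -> ~ d ⊑ bot -> d ⊑ e ->
    base (c * ir_star d).
  move=> nc ce nd de; case: (tot (c * ir_star d) e) => h.
    apply: base_neg => // h'; apply: nc; apply: (le_trans lat _ _ h').
    by apply: (leM1 dm); apply: star_ge1.
  suff -> : c * ir_star d = ir_star d by apply: base_star.
  apply: (le_anti lat); first by rewrite (mulC dm); apply: leMe.
  rewrite -{2}(star_idem de) (mulA dm) -[X in X ⊑ _](mul1 dm).
  exact: (leMl dm).
move=> ba bb; have sel : a * b = a \/ a * b = b -> base (a * b) by case=> ->.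
have [c [nc ce ac]] := ba; have [d [nd de bd]] := bb.
case: ac bd => [ac|ac] [bd|bd].
- apply: sel; rewrite ac bd; case: (tot c d) => h.
    by left; apply: (negative_mul dm).
  by right; rewrite (mulC dm); apply: (negative_mul dm).
- by rewrite ac bd; apply: mixed.
- by rewrite ac bd (mulC dm); apply: mixed.
- have pos u v : e ⊑ u -> u ⊑ v -> v * v = v -> u * v = v.
    move=> eu uv vv; apply: (le_anti lat).
      by rewrite -[X in _ ⊑ X]vv; apply: (leMl dm).
    by rewrite (mulC dm); apply: (leM1 dm).
  have ea : e ⊑ a by rewrite ac; apply: star_ge1.
  have eb : e ⊑ b by rewrite bd; apply: star_ge1.
  apply: sel; case: (tot a b) => h; first by right; apply: pos (base_idem bb).
  by left; rewrite (mulC dm); apply: pos (base_idem ba).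
Qed.

(** The implication is never below 0. If it is not negative, then either [b] is the star of some [d]
    and the implication is the star of [a * d], or [b] is negative, which forces a ≤ b ≤ e, and the
    implication is the star of [a]. *)
Lemma base_imp a b : base a -> base b -> base (a ⇒ b).
Proof.
move=> ba bb; have nr : ~ a ⇒ b ⊑ bot.
  have [c [nc ce _ ac]] := base_sandwich ba.
  have [d [nd de db _]] := base_sandwich bb.
  rewrite (leN dm) => h; apply: nd; rewrite (leNr dm).
  rewrite -(f2_mul nc (le_trans lat _ ce le_e_f2)) (mulC dm) -[X in _ ⊑ X](mul1 dm).
  apply: (le_trans lat (c * (a * ¬ b))); first exact: (leMr dm).
  rewrite (mulA dm); apply: (leM dm); last by rewrite (leN dm).
  by apply: (le_trans lat _ _ (starP dm c)); apply: (leMr dm).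
case: (pselect (a ⇒ b ⊑ e)) => re; first exact: base_neg.
have [d [nd de bd]] := bb; case: bd => bd; last first.
  have adE : a ⇒ b = ir_star (a * d).
    by rewrite bd !ir_starE /ir_imp (negK dm) (mulA dm).
  rewrite adE; have bad : base (a * d) by apply: base_mul => //; apply: base_neg.
  case: (tot (a * d) e) => h; first by apply: base_star => //; apply: base_nbot.
  by case: re; rewrite adE; apply: star_le1.
have ab : a ⊑ b.
  by rewrite -[a](mulr1 dm) (leM_impE dm); apply: (nle_le tot re).
have ae : a ⊑ e by apply: (le_trans lat _ ab); rewrite bd.
suff -> : a ⇒ b = ir_star a by apply: base_star => //; apply: base_nbot.
apply: (le_anti lat).
  rewrite -(leM_impE dm); apply: (le_trans lat b); last by rewrite bd.
  by rewrite (leM_impE dm); apply: lexx.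
rewrite -(leM_impE dm) -(negative_idem dm ae) -(mulA dm).
by apply: (le_trans lat _ _ ab); apply: (leMe dm); rewrite negative_idem //; apply: starP.
Qed.

(** In S[R(D)] the four cases are S without its unit, the bounds 0 and 1, D, and the copy D'. *)
Definition zoned x :=
  [\/ ~ inner x, x = bot \/ x = f2, base x | base (¬ x)].

Lemma zoned_subuniverse : ir_subuniverse zoned.
Proof.
have sel x y t : zoned x -> zoned y -> t = x \/ t = y -> zoned t.
  by move=> zx zy [->|->].
have zb : zoned bot by apply: Or42; left.
have zt : zoned f2 by apply: Or42; right.
have zN x : zoned x -> zoned (¬ x).
  case=> [h|[->|->]|h|h].
  - by apply: Or41; rewrite inner_neg.
  - by rewrite (negK dm).
  - by [].
  - by apply: Or44; rewrite (negK dm).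
  - exact: Or43.
split=> //; last 1 first.
- by apply: Or43; apply: base_e.
- have const x y : x = bot \/ x = f2 -> inner y -> zoned (x * y).
    move=> [->|->] iy; first by rewrite bot_mul_inner.
    case: (f2_mul_inner iy) => [->//|->].
    rewrite (mulC dm) bot_mul_inner //; split; [exact: bot_le_f2|exact: lexx].
  move=> x y zx zy.
  case: (pselect (inner x)) => ix; last by apply: sel zx zy _; apply: outer_mul_sel.
  case: (pselect (inner y)) => iy; last first.
    by rewrite (mulC dm); apply: sel zy zx _; apply: outer_mul_sel.
  case: zx => [//|cx|bx|bx]; first exact: const.
    case: zy => [//|cy|bY|bY]; first by rewrite (mulC dm); apply: const.
      by apply: Or43; apply: base_mul.
    (* For [x] and [¬ y] in D, the negation of [x * y] is the implication from [x] to [¬ y], which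
       is again in D. *)
    rewrite -(negK dm (x * y)); apply: zN; apply: Or43.
    by rewrite -{1}(negK dm y); apply: base_imp.
  case: zy => [//|cy|bY|bY]; first by rewrite (mulC dm); apply: const.
    rewrite -(negK dm (x * y)) (mulC dm); apply: zN; apply: Or43.
    by rewrite -{1}(negK dm x); apply: base_imp.
  by rewrite -(negK dm x) -(negK dm y) base_NN_mul.
- by move=> x y zx zy; apply: sel zx zy _; apply: meet_sel.
- by move=> x y zx zy; apply: sel zx zy _; apply: join_sel.
Qed.

(** A negative element lies outside [0, 1], equals 0, or is a negative element of D, so the zoned
    elements form a subuniverse containing all generators. *)
Lemma negatively_generated_zoned : negatively_generated C -> forall x, zoned x.
Proof.
move=> ng; apply: ng; first exact: zoned_subuniverse.
move=> a ae; case: (pselect (inner a)) => ia; last exact: Or41.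
case: (pselect (a ⊑ bot)) => ab; last by apply: Or43; apply: base_neg.
by apply: Or42; left; apply: (le_anti lat) ab ia.1.
Qed.

End DeMorganChain.

(** * The equation of condition (3) on chains *)

Definition nf_rhs (A : irAlg) (x : A) : A :=
  (t_d (t_sigma x) ⊓ t_sigma x) ⊔ (t_d' (t_sigma' x) ⊓ t_sigma' x)
  ⊔ ((ir_f2 A ⊔ ¬ ir_f2 A) ⇒ t_sigma' x).

Section NormalForm.
Variables (C : irAlg) (dm : is_DeMorgan C) (tot : totally_ordered C).
Let irl := dm_irl dm.
Let lat := irl_lattice irl.
Implicit Types x y : C.
Local Notation e := (@unit_e C).
Local Notation f := (ir_f C).
Local Notation f2 := (ir_f2 C).
Local Notation bot := (¬ f2).

(** The first two joinands are meets with [x], hence below it, and the third is [x]. *)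
Lemma nf_rhs_sigma_fixed x : t_sigma x = x -> t_sigma' x = x ->
  (f2 ⊔ bot) ⇒ x = x -> nf_rhs x = x.
Proof.
move=> s s' h; rewrite /nf_rhs s s' h; apply: (joinr lat).
by apply: (leUx lat); apply: (leIr lat).
Qed.

(** When [f] acts as a unit on [x] and [¬ x], star agrees with negation there, so the double star of
    [x] is [x]. *)
Lemma sigma_mulf x : x * f = x -> ¬ x * f = ¬ x -> t_sigma x = x.
Proof.
move=> xf nxf; case: (tot x e) => h; first exact: sigma_neg.
by rewrite (sigma_pos dm h) !ir_starE xf nxf (negK dm).
Qed.

Lemma nf_rhs_mulf_fixed x : x * f = x -> ¬ x * f = ¬ x ->
  (f2 ⊔ bot) ⇒ x = x -> nf_rhs x = x.
Proof.
move=> xf nxf; apply: nf_rhs_sigma_fixed; first exact: sigma_mulf.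
by rewrite /t_sigma' sigma_mulf ?(negK dm).
Qed.

Lemma nf_rhs_Sugihara x : f ⊑ e -> nf_rhs x = x.
Proof.
move=> fe; have idem := le_f_idem dm fe.
(* By idempotence f² = f, so the antecedent is f ∨ e = e. *)
have third y : (f2 ⊔ bot) ⇒ y = y.
  by rewrite /ir_f2 idem (negf dm) (joinr lat fe) (e_imp dm).
have low y : ~ f ⊑ y -> y * f = y /\ ¬ y * f = ¬ y.
  move=> nfy; have yf := nle_le tot nfy.
  split; first exact: (negative_mul dm).
  apply: (le_anti lat); first exact: leMe.
  by apply: (chain_absorb dm tot) => //; rewrite -(le_mulf dm) (leNl dm).
case: (pselect (f ⊑ x)) => fx; last first.
  by have [p q] := low x fx; apply: nf_rhs_mulf_fixed.
case: (pselect (x ⊑ e)) => xe.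
  by apply: nf_rhs_sigma_fixed => //; [apply: sigma_neg|apply: sigma'_ge_f].
have [|p q] := low (¬ x); first by rewrite (leNr dm) (negf dm).
by rewrite (negK dm) in q; apply: nf_rhs_mulf_fixed.
Qed.

Lemma nf_rhs_zoned x : ~ f ⊑ e -> zoned x -> nf_rhs x = x.
Proof.
move=> nfe.
have f2bot : f2 ⊔ bot = f2 by apply: (joinl lat) (bot_le_f2 dm tot nfe).
have inf : inner f by rewrite -(inner_neg dm) (negf dm); apply: inner_e.
have inf2 : inner f2 by split; [apply: bot_le_f2|apply: lexx].
have inbot : inner bot by rewrite (inner_neg dm).
have botf : bot * f = bot by apply: bot_mul_inner.
have f2f := f2_mulf dm tot nfe.
have f2bb : f2 * bot = bot by rewrite (mulC dm); apply: bot_mul_inner.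
have le_third y : (f2 ⊔ bot) ⇒ y ⊑ y.
  by apply: (imp_le dm); rewrite f2bot; apply: le_e_f2.
case=> [ox|cx|bx|bx].
(* Outside [0, 1], and at 0 and 1 in the next case, multiplication by [f] fixes both [x] and
   [¬ x]. *)
- have ox' : ~ inner (¬ x) by rewrite (inner_neg dm).
  apply: nf_rhs_mulf_fixed; rewrite ?outer_mul_inner //.
  by rewrite f2bot /ir_imp (mulC dm) outer_mul_inner // (negK dm).
- case: cx => ->; apply: nf_rhs_mulf_fixed; rewrite ?(negK dm) // f2bot /ir_imp.
    by rewrite (negK dm) (f2_idem dm tot nfe).
  by rewrite f2bb (negK dm).
(* On D the first joinand is [x], because σ fixes [x] and d(x) = f²; the other two lie below σ'(x) ≤
   x. *)
- have sx : t_sigma x = x.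
    have [c [nc ce [->|->]]] := bx; first exact: sigma_neg.
    by rewrite sigma_pos ?star3 //; apply: star_ge1.
  have dx : t_d x = f2.
    rewrite /t_d /t_d' (negK dm) (base_f2 dm tot nfe bx).
    rewrite (base_NN_mul dm tot nfe bx (base_e dm nfe)) /ir_imp f2bb (negK dm).
    exact: meetxx.
  have s'x : t_sigma' x ⊑ x by apply: sigma'_le => //; apply: base_le_f.
  have -> : nf_rhs x = x ⊔ (t_d' (t_sigma' x) ⊓ t_sigma' x)
                         ⊔ ((f2 ⊔ bot) ⇒ t_sigma' x).
    by rewrite /nf_rhs sx dx (meetr lat) //; apply: (base_inner dm tot nfe bx).2.
  have p1 := le_trans lat _ (leIr lat (t_d' (t_sigma' x)) _) s'x.
  have p2 := le_trans lat _ (le_third _) s'x.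
  by rewrite (joinl lat p1) (joinl lat p2).
(* On the negations of D the second joinand is [x], because σ' fixes [x] and d'(x) = f². The first
   one drops to 0, since σ(x) = f² and d(f²) ≤ 0, and the third is at most [x]. *)
- have s'x : t_sigma' x = x.
    rewrite /t_sigma'; have [c [nc ce nx]] := bx.
    suff -> : t_sigma (¬ x) = ¬ x by rewrite (negK dm).
    case: nx => ->; first exact: sigma_neg.
    by rewrite sigma_pos ?star3 //; apply: star_ge1.
  have [x0 x1] : inner x by rewrite -(inner_neg dm); apply: base_inner.
  have ex : e ⊑ x by have := base_le_f dm tot bx; rewrite (leN dm).
  have xf : x * f = f2.
    by rewrite -{1}(negK dm x) (base_NN_mul dm tot nfe bx (base_e dm nfe)).
  have d'x : t_d' x = f2.
    rewrite /t_d' (base_f2 dm tot nfe bx) xf /ir_imp f2bb (negK dm).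
    exact: meetxx.
  have sx : t_sigma x = f2.
    by rewrite (sigma_pos dm ex) !ir_starE xf botf (negK dm).
  have df2 : t_d f2 ⊑ bot.
    rewrite /t_d /t_d' botf; apply: (le_trans lat _ (leIl lat _ _)).
    by rewrite /ir_imp (negK dm) (f2_idem dm tot nfe); apply: lexx.
  rewrite /nf_rhs sx s'x d'x (meetr lat x1).
  have p1 := le_trans lat _ (le_trans lat _ (leIl lat _ f2) df2) x0.
  by rewrite (joinr lat p1) (joinl lat (le_third x)).
Qed.

Lemma negatively_generated_nf x : negatively_generated C -> nf_rhs x = x.
Proof.
move=> ng; case: (pselect (f ⊑ e)) => h; first exact: nf_rhs_Sugihara.
by apply: nf_rhs_zoned => //; apply: negatively_generated_zoned.
Qed.

End NormalForm.

(** * Transfer along embeddings and homomorphisms *)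

Section LmEmbedding.
Variables (L M : lmAlg) (h : L -> M) (hl : lm_hom h) (inj : injective h).

Lemma hom_leE x y : x ⊑ y <-> h x ⊑ h y.
Proof.
by rewrite /lm_le -(hom_meet hl); split=> [->|/inj].
Qed.

Lemma comm_monoid_embed : comm_monoid M -> comm_monoid L.
Proof.
move=> mon; split=> [x y z|x y|x]; apply: inj; rewrite !(hom_mul hl) ?(hom_unit hl).
- exact: (cm_assoc mon).
- exact: (cm_comm mon).
- exact: (cm_unit mon).
Qed.

Lemma lattice_embed : lattice M -> lattice L.
Proof.
move=> lat; split=> [x y|x y z|x y|x y z|x y|x y]; apply: inj;
  rewrite !(hom_meet hl, hom_join hl).
- exact: (lat_meetC lat).
- exact: (lat_meetA lat).
- exact: (lat_joinC lat).
- exact: (lat_joinA lat).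
- exact: (lat_meetK lat).
- exact: (lat_joinK lat).
Qed.

Lemma distributive_embed : distributive M -> distributive L.
Proof.
by move=> distr x y z; apply: inj; rewrite !(hom_meet hl, hom_join hl); apply: distr.
Qed.

Lemma totally_ordered_embed : totally_ordered M -> totally_ordered L.
Proof. by move=> tot x y; rewrite !hom_leE; apply: tot. Qed.

End LmEmbedding.

Section Homomorphism.
Variables (A B : irAlg) (h : A -> B) (hom : ir_hom h).
Let hl := hom.1.
Let hn := hom.2.

Lemma hom_nf_rhs x : h (nf_rhs x) = nf_rhs (h x).
Proof.
rewrite /nf_rhs /t_d /t_d' /t_sigma' /t_sigma /ir_star /ir_imp /ir_f2 /ir_f.
by rewrite !(hom_join hl, hom_meet hl, hom_mul hl, hn, hom_unit hl).
Qed.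

Lemma hom_le x y : x ⊑ y -> h x ⊑ h y.
Proof. by rewrite /lm_le -(hom_meet hl) => ->. Qed.

(** The preimage of a subuniverse is a subuniverse, and [h] sends negative elements to negative
    ones. *)
Lemma negatively_generated_image :
  (forall b, exists a, h a = b) -> negatively_generated A ->
  negatively_generated B.
Proof.
move=> surj ng P [Pm Pi Pj Pu Pn] negP b; have [a <-] := surj b.
apply: (ng (fun a => P (h a))); last first.
  by move=> x /hom_le; rewrite (hom_unit hl); apply: negP.
split=> [x y|x y|x y||x]; rewrite ?(hom_mul hl) ?(hom_meet hl) ?(hom_join hl)
  ?(hom_unit hl) ?hn; [exact: Pm|exact: Pi|exact: Pj|exact: Pu|exact: Pn].
Qed.

(** It yields the De Morgan axioms for S[R(D)] from its embedding into a given chain. *)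
Lemma DeMorgan_embed : injective h -> is_DeMorgan B -> is_DeMorgan A.
Proof.
move=> inj [[mon lat negK res] distr sq]; have leE := hom_leE hl inj.
split; [split|exact: distributive_embed hl inj distr|].
- exact: comm_monoid_embed hl inj mon.
- exact: lattice_embed hl inj lat.
- by move=> x; apply: inj; rewrite !hn negK.
- by move=> x y z; rewrite !leE !(hom_mul hl) !hn; apply: res.
- by move=> x; rewrite leE (hom_mul hl); apply: sq.
Qed.

End Homomorphism.

Lemma hom_inverse (A B : irAlg) (g : A -> B) :
  ir_hom g -> injective g -> (forall b, exists a, g a = b) ->
  exists k : B -> A, [/\ ir_hom k, injective k & forall a, exists b, k b = a].
Proof.
move=> [[gm gi gj gu] gn] inj surj; have [k kP] := choice surj.
exists k; split.
- by split; first split; move=> *; apply: inj; rewrite ?(gm, gi, gj, gn, gu) !kP.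
- by move=> x y /(congr1 g); rewrite !kP.
- by move=> a; exists (g a); apply: inj; rewrite kP.
Qed.

(** * The factors in (2) are negatively generated chains *)

(** By distributivity prelinearity reduces to [e] being below the join of the two implications; as f
    = e, this says that the negation of that join is below [e]. *)
Lemma odd_Sugihara_FSI_chain (S : irAlg) :
  is_odd_Sugihara S -> ir_FSI S -> totally_ordered S.
Proof.
move=> [[dm idem] fe] /(ir_FSI_rl_of (dm_irl dm)) fsi.
have lat := irl_lattice (dm_irl dm).
apply: (rl_FSI_chain (rl_of_RL (dm_irl dm)) _ fsi) => [x|x y].
  exact: (le_sqr dm).
rewrite /= ![_ ⊓ unit_e](lat_meetC lat) -(dm_distr dm).
apply: (le_anti lat); first exact: leIl.
apply: (lexI lat); first exact: lexx.
(* p ∧ q = (p ∧ q)² ≤ p q = (x ¬x)(y ¬y) ≤ f² = e for p = x ¬y and q = y ¬x. *)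
rewrite -[X in X ⊑ _](negK dm) (leNl dm) -/(ir_f S) fe.
set t := ¬ _; have [tx ty] : t ⊑ x * ¬ y /\ t ⊑ y * ¬ x.
  by split; rewrite /t (leNl dm); [apply: leUl|apply: leUr].
rewrite -(idem t) -fe -[X in _ ⊑ X]idem.
apply: (le_trans lat _ (leM dm tx ty)); rewrite (mulC dm y) (mulACA dm) (mulC dm _ y).
by apply: (leM dm); apply: mulN_lef.
Qed.

(** Idempotence gives f ≤ e, so an element that is not negative lies above [f] and its negation is
    negative. *)
Lemma Sugihara_chain_negatively_generated (C : irAlg) :
  is_Sugihara C -> totally_ordered C -> negatively_generated C.
Proof.
move=> [dm idem] tot P sP negP a.
case: (pselect (a ⊑ unit_e)) => ae; first exact: negP.
rewrite -(negK dm a); apply: (su_neg sP); apply: negP; rewrite (negN_le_f dm).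
by apply: (le_trans (irl_lattice (dm_irl dm)) _ (idem_le_f dm idem)); apply: (nle_le tot).
Qed.

Lemma rig_in_unit (S B : irAlg) (b : B) : rig_in b (@unit_e S) = inr b.
Proof. by rewrite /rig_in; case: pselect. Qed.

Lemma rig_in_neq (S B : irAlg) (b : B) (s : S) (ns : s <> unit_e) :
  rig_in b s = inl (exist _ s ns).
Proof.
rewrite /rig_in; case: pselect => // ns'.
by rewrite (Prop_irrelevance ns ns').
Qed.

Section FactorSRD.
Variables (S : irAlg) (D : rlAlg).
Hypotheses (oddS : is_odd_Sugihara S) (totS : totally_ordered S).
Hypotheses (gsD : is_gen_Sugihara D) (totD : totally_ordered D).
Local Notation C := (rigorous_ext S (reflection D)).
Let dmS := oddS.1.1.
Let latS := irl_lattice (dm_irl dmS).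
Let rlD := gs_rl gsD.
Let latD := rl_lattice rlD.

Lemma SRD_chain : totally_ordered C.
Proof.
move=> [[s ns]|b] [[t nt]|c]; rewrite /lm_le /=.
- case: (totS s t) => ->; first by left; apply: rig_in_neq.
  by right; apply: rig_in_neq.
- case: (totS unit_e s) => [->|/(meetr latS)->]; first by right; apply: rig_in_unit.
  by left; apply: rig_in_neq.
- case: (totS unit_e t) => [->|/(meetr latS)->]; first by left; apply: rig_in_unit.
  by right; apply: rig_in_neq.
- case: b c => [|a|a|] [|b|b|] /=; try by [left|right].
    by case: (totD a b) => ->; [left|right].
  case: (totD a b) => h.
    by rewrite [b ⊔ a](joinl latD h); right.
  by rewrite (joinl latD h); left.
Qed.

Lemma SRD_negatively_generated : negatively_generated C.
Proof.
move=> P sP negP.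
have pbase a : P (inr (Rbase a)).
  have low c : c ⊑ unit_e -> P (inr (Rbase c)).
    by move=> ce; apply: negP; rewrite /lm_le /= ce.
  case: (totD a unit_e) => ae; first exact: low.
  (* A positive [a] is a double star, and its single star is negative. In R(D) the outer star is the
     negation of a product with ¬e, so [a] is generated. *)
  have -> : a = rl_star (rl_star a) by have := gs_star gsD a; rewrite (joinl latD ae).
  have sa : rl_star a ⊑ unit_e.
    apply: (le_trans latD (a * rl_star a)); last exact: rl_impP.
    by rewrite -{1}[rl_star a](rl_mul1 rlD); apply: (rl_leM rlD) => //; apply: lexx.
  have := su_neg sP (su_mul sP (low _ sa) (su_neg sP (su_unit sP))).
  by [].
have pN (b : reflection D) : P (inr b) -> P (inr (¬ b)) by move/(su_neg sP).
move=> [[s ns]|[|a|a|]].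
- case: (totS s unit_e) => se.
    by apply: negP; rewrite /lm_le /= (meetr latS se); apply: rig_in_neq.
  have nns : ¬ s <> unit_e.
    by move=> h; apply: ns; rewrite -(negK dmS s) h; apply: oddS.2.
  have -> : inl (exist _ s ns) = ¬ (inl (exist _ (¬ s) nns) : C).
    by rewrite /= (negK dmS) (rig_in_neq _ ns).
  apply: (su_neg sP); apply: negP; rewrite /lm_le /= (meetr latS).
    exact: rig_in_neq.
  by rewrite (leNl dmS) -/(ir_f S) oddS.2.
- by apply: negP.
- exact: pbase.
- exact: pN (pbase a).
- by apply: (pN Rzero); apply: negP.
Qed.

End FactorSRD.

Lemma sval_inj (T : Type) (P : T -> Prop) : injective (@sval T P).
Proof.
by case=> x p [y q] /= xy; subst y; rewrite (Prop_irrelevance p q).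
Qed.

(** * Decomposing a chain: the odd Sugihara monoid S *)

Section ChainDecomposition.
Variables (C : irAlg) (dm : is_DeMorgan C) (tot : totally_ordered C).
Let irl := dm_irl dm.
Let lat := irl_lattice irl.
Implicit Types a b x y : C.
Local Notation e := (@unit_e C).
Local Notation f := (ir_f C).
Local Notation f2 := (ir_f2 C).
Local Notation bot := (¬ f2).
Hypotheses (nfe : ~ f ⊑ e) (zones : forall x, zoned x).

Lemma negU a b : ¬ (a ⊔ b) = ¬ a ⊓ ¬ b.
Proof.
case: (tot a b) => h.
  by rewrite (joinr lat h) (meetr lat) // (leN dm).
by rewrite (joinl lat h); apply/esym; rewrite -/(lm_le _ _) (leN dm).
Qed.

Lemma negI a b : ¬ (a ⊓ b) = ¬ a ⊔ ¬ b.
Proof. by rewrite -[RHS](negK dm) negU !(negK dm). Qed.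

Definition skel a := a = e \/ ~ inner a.

Lemma skel_sel a b t : skel a -> skel b -> t = a \/ t = b -> skel t.
Proof. by move=> sa sb [->|->]. Qed.

Lemma skel_mul a b : skel a -> skel b -> skel (a * b).
Proof.
move=> sa sb; apply: (skel_sel sa sb).
case: sa => [->|oa]; first by right; apply: mul1.
exact: outer_mul_sel.
Qed.

Lemma skel_meet a b : skel a -> skel b -> skel (a ⊓ b).
Proof. by move=> sa sb; apply: (skel_sel sa sb); apply: meet_sel. Qed.

Lemma skel_join a b : skel a -> skel b -> skel (a ⊔ b).
Proof. by move=> sa sb; apply: (skel_sel sa sb); apply: join_sel. Qed.

(** In C the negation of [e] is [f], an inner element; making [e] its own negation keeps the
    operation inside S and makes S odd. *)
Definition skel_neg a := if pselect (a = e) then e else ¬ a.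

Lemma skel_neg_e : skel_neg e = e.
Proof. by rewrite /skel_neg; case: pselect. Qed.

Lemma outer_neq_e a : ~ inner a -> a <> e.
Proof. by move=> oa ae; apply: oa; rewrite ae; apply: inner_e. Qed.

Lemma skel_neg_outer a : ~ inner a -> skel_neg a = ¬ a.
Proof. by move/outer_neq_e; rewrite /skel_neg; case: pselect. Qed.

Lemma skel_negP a : skel a -> skel (skel_neg a).
Proof.
move=> [->|oa]; first by rewrite skel_neg_e; left.
by rewrite skel_neg_outer //; right; rewrite (inner_neg dm).
Qed.

Definition skel_lm : lmAlg :=
  @LmAlg {a : C | skel a}
    (fun u v => exist _ _ (skel_mul (svalP u) (svalP v)))
    (fun u v => exist _ _ (skel_meet (svalP u) (svalP v)))
    (fun u v => exist _ _ (skel_join (svalP u) (svalP v)))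
    (exist _ e (or_introl erefl)).

Definition skel_alg : irAlg :=
  @IrAlg skel_lm (fun u => exist _ _ (skel_negP (svalP u))).

Lemma skel_hom : lm_hom (sval : skel_lm -> C). Proof. by []. Qed.

(** An element of S is below [e] exactly when it is below [f], since those outside [0, 1] cannot
    separate the two. So [e] takes over the role that [f] has in C. *)
Lemma skel_neg_le u z : skel u -> skel z -> u ⊑ z <-> u * skel_neg z ⊑ e.
Proof.
have lef s : skel s -> s ⊑ e <-> s ⊑ f.
  move=> ss; split=> h; first exact: (le_trans lat _ h (le_e_f tot nfe)).
  case: ss => [->|/not_innerP os]; first exact: lexx.
  have sf2 := le_trans lat _ h (le_f_f2 dm tot nfe).
  case: os => // /(nle_le tot) h'; exact: (le_trans lat _ h' (bot_le_e dm tot nfe)).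
move=> su [->|oz]; first by rewrite skel_neg_e (mulr1 dm).
rewrite lef; last by apply: skel_mul => //; apply: skel_negP; right.
by rewrite skel_neg_outer // -(le_mulf dm).
Qed.

Lemma skel_negK a : skel a -> skel_neg (skel_neg a) = a.
Proof.
move=> [->|oa]; first by rewrite !skel_neg_e.
by rewrite (skel_neg_outer oa) skel_neg_outer ?(negK dm) // (inner_neg dm).
Qed.

Lemma skel_odd_Sugihara : is_odd_Sugihara skel_alg.
Proof.
have inj := @sval_inj C skel.
split; last by apply: inj => /=; apply: skel_neg_e.
split; last first.
  case=> a [ae|oa]; apply: inj; rewrite /=; first by rewrite ae (mul1 dm).
  by case: (outer_mul_sel dm tot nfe a oa).
split; [split|exact: distributive_embed skel_hom inj (dm_distr dm)|].
- exact: comm_monoid_embed skel_hom inj (irl_monoid irl).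
- exact: lattice_embed skel_hom inj lat.
- by move=> [a sa]; apply: inj => /=; apply: skel_negK.
- move=> [x sx] [y sy] [z sz]; rewrite !(hom_leE skel_hom inj) /=.
  have nz := skel_negP sz; have nx := skel_negP sx.
  (* Both sides of the residuation law become the same bound: the product of [x], [y] and
     [skel_neg z] is below [e]. *)
  rewrite (skel_neg_le (skel_mul sx sy) sz) (skel_neg_le (skel_mul nz sy) nx).
  by rewrite skel_negK // -(mulA dm) (mulC dm x) (mulC dm y).
- by move=> [a sa]; rewrite (hom_leE skel_hom inj) /=; apply: le_sqr.
Qed.

Lemma skel_FSI : ir_FSI skel_alg.
Proof.
have irlS := dm_irl skel_odd_Sugihara.1.1.
rewrite (ir_FSI_rl_of irlS); apply: rl_chain_FSI (rl_of_RL irlS) _.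
exact: totally_ordered_embed skel_hom (@sval_inj C skel) tot.
Qed.

(** * Decomposing a chain: the generalized Sugihara monoid D *)

Lemma base_meet a b : base a -> base b -> base (a ⊓ b).
Proof. by move=> ba bb; case: (meet_sel lat a b tot) => ->. Qed.

Lemma base_join a b : base a -> base b -> base (a ⊔ b).
Proof. by move=> ba bb; case: (join_sel lat a b tot) => ->. Qed.

Definition base_lm : lmAlg :=
  @LmAlg {a : C | base a}
    (fun u v => exist _ _ (base_mul dm tot (svalP u) (svalP v)))
    (fun u v => exist _ _ (base_meet (svalP u) (svalP v)))
    (fun u v => exist _ _ (base_join (svalP u) (svalP v)))
    (exist _ e (base_e dm nfe)).

Definition base_alg : rlAlg :=
  @RlAlg base_lm (fun u v => exist _ _ (base_imp dm tot nfe (svalP u) (svalP v))).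

Lemma base_hom : lm_hom (sval : base_lm -> C). Proof. by []. Qed.

Lemma base_RL : is_RL base_alg.
Proof.
have inj := @sval_inj C (@base C).
split.
- exact: comm_monoid_embed base_hom inj (irl_monoid irl).
- exact: lattice_embed base_hom inj lat.
- by move=> x y z; rewrite !(hom_leE base_hom inj) /=; apply: leM_impE.
Qed.

Lemma base_chain : totally_ordered base_alg.
Proof. exact: totally_ordered_embed base_hom (@sval_inj C (@base C)) tot. Qed.

Lemma base_FSI : rl_FSI base_alg.
Proof. exact: rl_chain_FSI base_RL base_chain. Qed.

(** As a chain, D is its own one-factor subdirect representation. A base element above [e] is [e] or
    a star, and a triple star equals a single one. *)
Lemma base_gen_Sugihara : is_gen_Sugihara base_alg.
Proof.
split; first exact: base_RL.
- exists unit, (fun=> base_alg), (fun d _ => d); split => //.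
  + by move=> _; split; [apply: base_RL|apply: base_chain].
  + by move=> x y /(congr1 (fun k => k tt)).
  + by move=> _ b; exists b.
- by move=> [a ba]; apply: (@sval_inj C (@base C)); apply: base_idem.
have starE (u : base_alg) : sval (rl_star u) = ir_star (sval u) by [].
move=> [a ba]; apply: (@sval_inj C (@base C)); rewrite !starE /=.
case: (tot a e) => h; first by rewrite (joinr lat h) !(star_e dm).
rewrite (joinl lat h); have [c [nc ce [ac|->]]] := ba; last exact: star3.
have -> : a = e by apply: (le_anti lat) => //; rewrite ac.
by rewrite !(star_e dm).
Qed.

(** * Decomposing a chain: the isomorphism from S[R(D)] *)

Local Notation RD := (reflection base_alg).
Local Notation SRD := (rigorous_ext skel_alg RD).

Definition refl_map (r : RD) : C :=
  match r with
  | Rzero => bot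
  | Rbase d => sval d
  | Rprime d => ¬ sval d
  | Rone => f2
  end.

Lemma f2_inner : inner f2.
Proof. by split; [apply: bot_le_f2|apply: lexx]. Qed.

Lemma refl_map_inner r : inner (refl_map r).
Proof.
case: r => [|[a ba]|[a ba]|] /=; rewrite ?(inner_neg dm);
  try exact: f2_inner; exact: base_inner.
Qed.

Lemma refl_map_neg r : refl_map (¬ r) = ¬ refl_map r.
Proof. by case: r => [|a|a|] //=; rewrite (negK dm). Qed.

Lemma base_le_neg a b : base a -> base b -> a ⊑ ¬ b.
Proof. by move=> ba bb; apply: (nle_le tot); apply: base_lt_neg. Qed.

Lemma refl_map_meet r s : refl_map (r ⊓ s) = refl_map r ⊓ refl_map s.
Proof.
have [r0 r1] := refl_map_inner r; have [s0 s1] := refl_map_inner s.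
case: r s r0 r1 s0 s1 => [|[a ba]|[a ba]|] [|[b bb]|[b bb]|] //= r0 r1 s0 s1;
  try (by apply/esym); try (by apply/esym; apply: (meetr lat)).
- by apply/esym; apply: base_le_neg.
- by apply/esym; apply: (meetr lat); apply: base_le_neg.
- exact: negU.
Qed.

Lemma refl_map_join r s : refl_map (r ⊔ s) = refl_map r ⊔ refl_map s.
Proof.
have -> : r ⊔ s = ¬ (¬ r ⊓ ¬ s) by case: r s => [|a|a|] [|b|b|].
by rewrite refl_map_neg refl_map_meet !refl_map_neg negI !(negK dm).
Qed.

Lemma refl_map_mul r s : refl_map (r * s) = refl_map r * refl_map s.
Proof.
have bm b : inner b -> bot * b = bot by apply: bot_mul_inner.
have [ir is_] := (refl_map_inner r, refl_map_inner s).
have nb b : base b -> f2 * ¬ b = f2.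
  move=> bb; have [b0 b1] := base_inner dm tot nfe bb.
  apply: f2_mul => //; last by rewrite (leNl dm).
  rewrite (leN dm) => h; apply: (nle_f2_f dm nfe).
  exact: (le_trans lat _ h (base_le_f dm tot bb)).
have bf b : base b -> f2 * b = f2 by apply: base_f2.
case: r s ir is_ => [|[a ba]|[a ba]|] [|[b bb]|[b bb]|] //= ir is_; apply/esym;
  try exact: bm; try exact: bf; try exact: nb;
  try (by rewrite (mulC dm) bm); try (by rewrite (mulC dm) bf);
  try (by rewrite (mulC dm) nb).
- by rewrite -{1}(negK dm (a * ¬ b)).
- by rewrite (mulC dm) -{1}(negK dm (b * ¬ a)).
- exact: base_NN_mul.
- exact: f2_idem.
Qed.

Definition srd_map (u : SRD) : C :=
  match u with
  | inl s => sval (sval s)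
  | inr r => refl_map r
  end.

Lemma srd_map_in (r : RD) (s : skel_alg) :
  srd_map (rig_in r s) = if pselect (sval s = e) then refl_map r else sval s.
Proof.
rewrite /rig_in; case: pselect => [->|ns]; case: pselect => //= h.
by case: ns; apply: (@sval_inj C skel).
Qed.

Lemma skel_neq_outer (s : skel_alg) : s <> unit_e -> ~ inner (sval s).
Proof.
by case: s => a [ae|//] ns; case: ns; apply: (@sval_inj C skel).
Qed.

(** One argument serves product, meet and join. The last hypothesis mirrors the mixed clause of the
    rigorous extension: what an outer [a] does to [e] decides whether [a] or the inner [b]
    survives. *)
Lemma srd_map_op (opS : skel_alg -> skel_alg -> skel_alg)
    (opR : RD -> RD -> RD) (op : C -> C -> C) :
  commutative op ->
  (forall s t, sval (opS s t) = op (sval s) (sval t)) ->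
  (forall r s, refl_map (opR r s) = op (refl_map r) (refl_map s)) ->
  (forall a b, ~ inner a -> inner b ->
     op e a = e /\ op a b = b \/ op e a = a /\ op a b = a) ->
  forall u v, srd_map (rig_op opS opR u v) = op (srd_map u) (srd_map v).
Proof.
move=> opC Sm Rm mixed [[s ns]|r] [[t nt]|r'] /=; last exact: Rm.
(* Should the result in S be [e], the default unit of R(D) is also mapped to [e]. *)
- by rewrite srd_map_in Sm; case: pselect.
- have os := skel_neq_outer ns; rewrite srd_map_in Sm /=.
  case: (mixed _ _ os (refl_map_inner r')) => -[-> ->]; case: pselect => //.
  by move=> h; case: (outer_neq_e os).
- have ot := skel_neq_outer nt; rewrite srd_map_in Sm /= [RHS]opC.
  case: (mixed _ _ ot (refl_map_inner r)) => -[-> ->]; case: pselect => //.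
  by move=> h; case: (outer_neq_e ot).
Qed.

Lemma srd_map_hom : ir_hom srd_map.
Proof.
have ext a : ~ inner a -> a ⊑ bot \/ f2 ⊑ a by apply: not_inner_extreme.
split; first split=> //.
- apply: srd_map_op => //; first exact: mulC.
  + exact: refl_map_mul.
  + by move=> a b oa ib; right; rewrite (mul1 dm) outer_mul_inner.
- apply: srd_map_op => //; first exact: (lat_meetC lat).
  + exact: refl_map_meet.
  + move=> a b /ext [l|h] [b0 b1]; [right|left]; split.
    * by apply: (meetr lat); apply: (le_trans lat _ l (bot_le_e dm tot nfe)).
    * exact: (le_trans lat _ l).
    * exact: (le_trans lat _ (le_e_f2 dm tot nfe) h).
    * by apply: (meetr lat); apply: (le_trans lat _ b1).
- apply: srd_map_op => //; first exact: (lat_joinC lat).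
  + exact: refl_map_join.
  + move=> a b /ext [l|h] [b0 b1]; [left|right]; split.
    * by apply: (joinl lat); apply: (le_trans lat _ l (bot_le_e dm tot nfe)).
    * by apply: (joinr lat); apply: (le_trans lat _ l).
    * by apply: (joinr lat); apply: (le_trans lat _ (le_e_f2 dm tot nfe) h).
    * by apply: (joinl lat); apply: (le_trans lat _ b1).
case=> [[s ns]|r] /=; last exact: refl_map_neg.
have os := skel_neq_outer ns.
by rewrite srd_map_in /= skel_neg_outer //; case: pselect.
Qed.

(** The zones have disjoint images: S without [e] lands outside [0, 1], D avoids 0, 1 and its own
    negations. *)
Lemma srd_map_inj : injective srd_map.
Proof.
have base_f2F a : base a -> a <> f2.
  by move=> /(base_le_f dm tot) + E; rewrite E; apply: nle_f2_f.
have base_botF a : base a -> a <> bot.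
  by move=> /(base_nbot dm) + E; apply; rewrite E; apply: lexx.
have base_negF a b : base a -> base b -> a <> ¬ b.
  by move=> ba bb E; apply: (base_lt_neg dm tot nfe ba bb); rewrite -E; apply: lexx.
have bot_f2F : bot <> f2.
  by move=> E; apply: (nle_e_bot dm nfe); rewrite E; apply: le_e_f2.
have ninj a b : ¬ a = b -> a = ¬ b by move=> <-; rewrite (negK dm).
case=> [[s ns]|r] [[t nt]|r'] /=.
- by move=> /(@sval_inj C skel) E; subst t; rewrite (Prop_irrelevance ns nt).
- by move=> E; case: (skel_neq_outer ns); rewrite E; apply: refl_map_inner.
- by move=> E; case: (skel_neq_outer nt); rewrite -E; apply: refl_map_inner.
case: r r' => [|[a ba]|[a ba]|] [|[b bb]|[b bb]|] //= E.
- by case: (base_botF _ bb).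
- by case: (base_f2F _ bb); rewrite -(negK dm b) -E (negK dm).
- by case: (base_botF _ ba).
- by subst b; rewrite (Prop_irrelevance ba bb).
- by case: (base_negF _ _ ba bb).
- by case: (base_f2F _ ba).
- by case: (base_f2F _ ba); rewrite -(negK dm a) E (negK dm).
- by case: (base_negF _ _ bb ba).
- have {}E : a = b by rewrite -(negK dm a) E (negK dm).
  by subst b; rewrite (Prop_irrelevance ba bb).
- by case: (base_botF _ ba); apply: ninj.
- by case: bot_f2F.
- by case: (base_f2F _ bb).
- by case: (base_botF _ bb); apply: ninj.
Qed.

(** The assumption that every element is zoned enters here and makes the embedding onto. *)
Lemma srd_map_surj x : exists u, srd_map u = x.
Proof.
case: (zones x) => [ox|[->|->]|bx|bx].
- have ns : (exist _ x (or_intror ox) : skel_alg) <> unit_e.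
    by move=> /(congr1 sval) /=; apply: outer_neq_e.
  by exists (inl (exist (fun s : skel_alg => s <> unit_e) _ ns)).
- by exists (inr Rzero).
- by exists (inr Rone).
- by exists (inr (Rbase (exist _ x bx))).
- by exists (inr (Rprime (exist _ _ bx))); rewrite /= (negK dm).
Qed.

End ChainDecomposition.

(** * The equivalence of the three conditions *)

Definition factor (C : irAlg) : Prop :=
  (is_Sugihara C /\ totally_ordered C) \/ (is_DeMorgan C /\ of_form_SRD C).

Lemma factor_nf (C : irAlg) (x : C) : factor C -> nf_rhs x = x.
Proof.
case=> [[sC totC]|[dmC]].
  apply: negatively_generated_nf => //; first exact: sC.1.
  exact: Sugihara_chain_negatively_generated.
move=> [S [D [oS fS gD fD E]]]; subst C.
have totS := odd_Sugihara_FSI_chain oS fS.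
have totD := gen_Sugihara_FSI_chain gD fD.
apply: negatively_generated_nf => //; first exact: SRD_chain.
exact: SRD_negatively_generated.
Qed.

(** A chain with f ≤ e is already a Sugihara factor. Otherwise, since a factor must be literally of
    the form S[R(D)], the chain is replaced by that copy through the inverse of [srd_map]. *)
Lemma chain_factor (C : irAlg) :
  is_DeMorgan C -> totally_ordered C -> negatively_generated C ->
  exists (E : irAlg) (k : C -> E),
    [/\ factor E, ir_hom k, injective k & forall u, exists b, k b = u].
Proof.
move=> dm tot ng; case: (pselect (ir_f C ⊑ unit_e)) => h.
  exists C, id; split=> //; last by move=> u; exists u.
  by left; split=> //; split=> //; apply: le_f_idem.
have zones := negatively_generated_zoned dm tot h ng.
have ghom := srd_map_hom dm tot h.
have ginj := @srd_map_inj C dm tot h.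
have [k [khom kinj ksurj]] := hom_inverse ghom ginj (srd_map_surj dm tot h zones).
eexists; exists k; split=> //; right; split; first exact: DeMorgan_embed ghom ginj dm.
exists (skel_alg dm tot h), (base_alg dm tot h); split=> //.
- exact: skel_odd_Sugihara.
- exact: skel_FSI.
- exact: base_gen_Sugihara.
- exact: base_FSI.
Qed.

Lemma nf_negatively_generated (A : irAlg) : is_DeMorgan A ->
  (forall x : A, nf_rhs x = x) -> negatively_generated A.
Proof.
move=> dm nf P [Pm Pi Pj Pu Pn] negP x.
have Pimp y z : P y -> P z -> P (y ⇒ z) by move=> py pz; apply/Pn/Pm/Pn.
have Pf2 : P (ir_f2 A) by apply: Pm; apply: Pn.
have lat := irl_lattice (dm_irl dm).
have Ps y : P (t_sigma y).
  by apply: Pm; last apply: Pimp => //; apply: negP; apply: leIr.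
have Ps' : P (t_sigma' x) by apply: Pn.
have Pd' y : P y -> P (t_d' y).
  by move=> py; apply: Pi; [apply: Pimp => //; apply: Pm => //|apply: Pm => //];
     apply: Pn.
rewrite -(nf x); apply: (Pj); last by apply: Pimp => //; apply: Pj => //; apply: Pn.
by apply: Pj; apply: Pi => //; apply: Pd' => //; apply: Pn.
Qed.

Theorem theorem7p22 (A : irAlg) (dmA : is_DeMorgan A) (slA : semilinear A) :
  let cond1 := negatively_generated A in
  let cond2 :=
    ir_subdirect_of
      (fun C : irAlg => (is_Sugihara C /\ totally_ordered C) \/
                        (is_DeMorgan C /\ of_form_SRD C))
      A in
  let cond3 :=
    forall x : A,
      x = (t_d (t_sigma x) ⊓ t_sigma x)
          ⊔ (t_d' (t_sigma' x) ⊓ t_sigma' x)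
          ⊔ ((ir_f2 A ⊔ ¬ ir_f2 A) ⇒ t_sigma' x) in
  (cond1 <-> cond2) /\ (cond2 <-> cond3).
Proof.
move=> cond1 cond2 cond3.
have proj_hom (I : Type) (B : I -> irAlg) (h : A -> ir_prod B) i :
    ir_hom h -> ir_hom (fun a => h a i).
  move=> [hl hn]; split; first split; move=> *;
  by rewrite ?(hom_mul hl, hom_meet hl, hom_join hl, hom_unit hl, hn).
have c12 : cond1 -> cond2.
  move=> ng; have [I [B [h [KB hh inj surj]]]] := slA.
  (* Each coordinate is an image of A, hence a negatively generated chain; an admissible copy of it
     and an isomorphism are chosen for every index. *)
  have ex i : {E : irAlg & {k : B i -> E |
      [/\ factor E, ir_hom k, injective k & forall u, exists b, k b = u]}}.
    have [dmB totB] := KB i.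
    have ngB := negatively_generated_image (proj_hom _ _ _ i hh) (surj i) ng.
    have /cid[E /cid kP] := chain_factor dmB totB ngB.
    by exists E.
  pose k i := sval (projT2 (ex i)).
  have kP i : [/\ factor (projT1 (ex i)), ir_hom (k i), injective (k i)
               & forall u, exists b, k i b = u] := svalP (projT2 (ex i)).
  exists I, (fun i => projT1 (ex i)), (fun a i => k i (h a i)); split.
  - by move=> i; case: (kP i).
  - have khom i : ir_hom (fun a => k i (h a i)).
      have [_ [kl kn] _ _] := kP i; have [hl hn] := proj_hom _ _ _ i hh.
      split=> [|x]; last by rewrite hn kn.
      split=> [x y|x y|x y|].
      + by rewrite (hom_mul hl) (hom_mul kl).
      + by rewrite (hom_meet hl) (hom_meet kl).
      + by rewrite (hom_join hl) (hom_join kl).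
      + by rewrite (hom_unit hl) (hom_unit kl).
    split=> [|x]; last by apply: functional_extensionality_dep => i; apply: (khom i).2.
    split=> *; apply: functional_extensionality_dep => i.
    + exact: (hom_mul (khom i).1).
    + exact: (hom_meet (khom i).1).
    + exact: (hom_join (khom i).1).
    + exact: (hom_unit (khom i).1).
  - move=> x y E; apply: inj; apply: functional_extensionality_dep => i.
    have [_ _ kinj _] := kP i; apply: kinj.
    exact: (congr1 (fun u => u i) E).
  - move=> i u; have [_ _ _ ksurj] := kP i; have [b <-] := ksurj u.
    by have [a <-] := surj i b; exists a.
have c23 : cond2 -> cond3.
  move=> [I [B [h [KB hh inj _]]]] x; apply: inj.
  apply: functional_extensionality_dep => i; rewrite -/(nf_rhs x).
  by rewrite (hom_nf_rhs (proj_hom _ _ _ i hh)) factor_nf.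
have c31 : cond3 -> cond1.
  by move=> c3; apply: nf_negatively_generated => // x; rewrite -[RHS]c3.
by split; split; auto.
Qed.
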